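(* Let $\Omega=(a,b)\subset\mathbb{R}$ be a finite interval, $0<\alpha<1$, $u\in L^1(\Omega)$ and $v\in L^1_{loc}(\Omega)$. For each choice of sign $\pm$: $v={}^{\pm}\mathcal{D}^{\alpha}u$ (i.e. the weak fractional derivative exists in $L^1_{loc}(\Omega)$ and equals $v$) if and only if there exists a sequence $\{u_j\}_{j=1}^\infty\subset C^\infty(\Omega)$ such that $u_j\to u$ in $L^1(\Omega)$ and ${}^{\pm}\mathcal{D}^{\alpha}u_j\to v$ in $L^1_{loc}(\Omega)$ as $j\to\infty$.
   Context: Fractional integrals on $(a,b)$, for $\sigma>0$: ${}^{-}I^{\sigma}f(x)=\frac{1}{\Gamma(\sigma)}\int_a^x\frac{f(y)}{(x-y)^{1-\sigma}}\,dy$ and ${}^{+}I^{\sigma}f(x)=\frac{1}{\Gamma(\sigma)}\int_x^b\frac{f(y)}{(y-x)^{1-\sigma}}\,dy$. Riemann-Liouville derivatives for $0<\alpha<1$: ${}^{-}D^{\alpha}\varphi=\frac{d}{dx}\,{}^{-}I^{1-\alpha}\varphi$ and ${}^{+}D^{\alpha}\varphi=-\frac{d}{dx}\,{}^{+}I^{1-\alpha}\varphi$. Weak fractional derivatives ($0<\alpha<1$): for $u\in L^1(\Omega)$, a function $v\in L^1_{loc}(\Omega)$ is the left (resp. right) weak fractional derivative of $u$, written $v={}^{-}\mathcal{D}^{\alpha}u$ (resp. $v={}^{+}\mathcal{D}^{\alpha}u$), if $\int_\Omega v\varphi\,dx=\int_\Omega u\,{}^{+}D^{\alpha}\varphi\,dx$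 (resp. $\int_\Omega v\varphi\,dx=\int_\Omega u\,{}^{-}D^{\alpha}\varphi\,dx$) for all $\varphi\in C_0^\infty(\Omega)$. Implicit in the convergence statements is that $u_j\in L^1(\Omega)$ and that ${}^{\pm}\mathcal{D}^{\alpha}u_j$ exists in $L^1_{loc}(\Omega)$. *)

(* Defs.v *)
From HB Require Import structures.
From mathcomp Require Import all_boot all_order all_algebra.
From mathcomp Require Import all_classical all_reals all_analysis.

Set Implicit Arguments.
Unset Strict Implicit.
Unset Printing Implicit Defensive.

Import Order.TTheory GRing.Theory Num.Theory.
Import numFieldNormedType.Exports.

Local Open Scope classical_set_scope.
Local Open Scope ring_scope.

(* [Left] is the superscript "-" (integration from the left endpoint [a]),
   [Right] is the superscript "+" (integration up to the right endpoint [b]). *)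
Inductive side := Left | Right.

Definition opposite (s : side) : side :=
  match s with Left => Right | Right => Left end.

Definition Gamma {R : realType} (s : R) : R :=
  \int[lebesgue_measure]_(t in `]0, +oo[) (t `^ (s - 1) * expR (- t)).

Definition frac_int {R : realType} (s : side) (a b sigma : R) (f : R -> R)
    (x : R) : R :=
  match s with
  | Left => (Gamma sigma)^-1 *
      \int[lebesgue_measure]_(y in `]a, x[) (f y / (x - y) `^ (1 - sigma))
  | Right => (Gamma sigma)^-1 *
      \int[lebesgue_measure]_(y in `]x, b[) (f y / (y - x) `^ (1 - sigma))
  end.

(* Riemann-Liouville derivatives *)
Definition RL_deriv {R : realType} (s : side) (a b alpha : R) (f : R -> R)
    (x : R) : R :=
  match s with
  | Left => derive1 (frac_int Left a b (1 - alpha) f) x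
  | Right => - derive1 (frac_int Right a b (1 - alpha) f) x
  end.

(* [D] is meant to be open, so that only the values of [f] on [D] matter. *)
Definition smooth_on {R : realType} (D : set R) (f : R -> R) : Prop :=
  forall (n : nat) (x : R), D x -> derivable (derive1n n f) x 1.

(* Elements of C_0^oo(D) are represented by their extension by zero to [R]. *)
Definition test_function {R : realType} (D : set R) (phi : R -> R) : Prop :=
  [/\ smooth_on D phi,
      compact (closure [set x | phi x != 0]) &
      closure [set x | phi x != 0] `<=` D].

Definition L1 {R : realType} (D : set R) (f : R -> R) : Prop :=
  lebesgue_measure.-integrable D (EFin \o f).

(* Functions are representatives of their a.e. classes, hence a weak
   derivative is a relation: [v] represents the weak derivative of [u]. *)
Definition is_weak_frac_deriv {R : realType} (s : side) (a b alpha : R)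
    (u v : R -> R) : Prop :=
  [/\ L1 `]a, b[ u, locally_integrable `]a, b[ v &
      forall phi : R -> R, test_function `]a, b[ phi ->
        \int[lebesgue_measure]_(x in `]a, b[) (v x * phi x) =
        \int[lebesgue_measure]_(x in `]a, b[)
          (u x * RL_deriv (opposite s) a b alpha phi x)].

Definition cvg_L1 {R : realType} (D : set R) (f_ : nat -> R -> R) (f : R -> R)
    : Prop :=
  (\int[lebesgue_measure]_(x in D) (`|f_ j x - f x|)%:E)%E @[j --> \oo]
    --> (0 : \bar R)%E.

Definition cvg_L1loc {R : realType} (D : set R) (f_ : nat -> R -> R)
    (f : R -> R) : Prop :=
  forall K : set R, K `<=` D -> compact K -> cvg_L1 K f_ f.

(* Main.v *)
Require Import Defs.
From HB Require Import structures.
From mathcomp Require Import all_boot all_order all_algebra.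
From mathcomp Require Import all_classical all_reals all_analysis.
From mathcomp Require Import measurable_realfun ring lra.

(* For a weak derivative [v] of [u], mollify with kernels [eta_j] supported on
   one side of [0], the side from which the fractional integral comes:
   [u_j x = \int_a^b u y * eta_j (x - y) dy] then only involves the values of [u]
   before [x], so that extending [u] by zero outside [(a, b)] does no harm, and
   by Fubini [u_j] has the smooth weak derivative
   [v_j x = \int_a^b u y * G_j (x - y) dy], [G_j] being the fractional derivative
   of [eta_j]. When [x] stays in a compact set and [j] is large, [eta_j (x - .)]
   is a test function whose Riemann-Liouville derivative is [G_j (x - .)], hence
   [v_j x = \int_a^b v y * eta_j (x - y) dy], and both convergences are those of
   L^1 mollification. Conversely, the defining identity passes to the limit
   because a test function and its Riemann-Liouville derivative are bounded. *)

Import Order.TTheory GRing.Theory Num.Theory.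
Import numFieldNormedType.Exports.

Local Open Scope classical_set_scope.
Local Open Scope ring_scope.

Set Implicit Arguments.
Unset Strict Implicit.
Unset Printing Implicit Defensive.

(** Two obstacles shape the proof: the kernel t^(-alpha) is unbounded at 0, and a limit of
    integration in the fractional integral moves with x. Substituting y = x + e * t, with e = 1 or
    -1 according to the side, and using that a test function vanishes outside (a, b), one integrates
    over the fixed interval (0, b - a), and x occurs only inside the test function: the derivative
    falls on it, never on the kernel. Everything, mollification included, then pairs an integrable
    factor with a factor whose derivatives are all bounded on the whole line. These two classes are
    enough both to differentiate under the integral and to apply Fubini, and the sign e treats the
    two sides at once. *)

(** * Functions with bounded derivatives *)

Section smooth.
Context {R : realType}.
Local Notation mu := (@lebesgue_measure R).
Implicit Types (f g k phi : R -> R) (A B : set R).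

(** This class takes the place of the compactly supported smooth functions: it survives convolution
    with an integrable factor, which may destroy compact support, and its uniform bounds provide the
    dominating functions. *)
Definition bounded_derivatives g := forall n,
  (forall x, derivable (derive1n n g) x 1) /\
  exists M, forall x, `|derive1n n g x| <= M.

Lemma derive1n_chain (F : nat -> R -> R) :
  (forall n (x : R), is_derive x 1 (F n) (F n.+1 x)) ->
  forall n, derive1n n (F 0%N) = F n.
Proof.
move=> FS; elim=> [//|n IH]; rewrite derive1nS IH; apply/funext => x.
by rewrite derive1E; case: (FS n x) => _ ->.
Qed.

(** Smoothness is always proved by guessing all derivatives at once, as a sequence in which each
    term differentiates to the next. *)
Lemma bounded_derivatives_chain (F : nat -> R -> R) :
  (forall n (x : R), is_derive x 1 (F n) (F n.+1 x)) ->
  (forall n, exists M, forall x, `|F n x| <= M) ->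
  bounded_derivatives (F 0%N).
Proof.
move=> FS Fb n; rewrite (derive1n_chain FS); split; last exact: Fb.
by move=> x; case: (FS n x).
Qed.

Lemma bounded_derivatives_is_derive g : bounded_derivatives g ->
  forall n (x : R), is_derive x 1 (derive1n n g) (derive1n n.+1 g x).
Proof.
by move=> bg n x; rewrite derive1nS derive1E; apply: derivableP; case: (bg n).
Qed.

Lemma bounded_derivatives_bound g : bounded_derivatives g ->
  exists M, forall x, `|g x| <= M.
Proof. by move=> /(_ 0%N)[]. Qed.

Lemma bounded_derivatives_derive1 g : bounded_derivatives g ->
  bounded_derivatives (derive1 g).
Proof. by move=> bg n; have := bg n.+1; rewrite derive1Sn. Qed.

Lemma bounded_derivatives_continuous g : bounded_derivatives g -> continuous g.
Proof.
by move=> /(_ 0%N)[dg _] x; apply/differentiable_continuous/derivable1_diffP/dg.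
Qed.

Lemma bounded_derivativesZ (c : R) g : bounded_derivatives g ->
  bounded_derivatives (fun x => c * g x).
Proof.
move=> bg; apply: (@bounded_derivatives_chain (fun n x => c * derive1n n g x)).
  by move=> n x; apply: is_deriveZ; exact: bounded_derivatives_is_derive.
move=> n; have [_ [M gM]] := bg n; exists (`|c| * M) => x.
by rewrite normrM ler_wpM2l.
Qed.

Lemma is_derive1_affine g (x0 s x dg : R) :
  is_derive (x0 + s * x) 1 g dg ->
  is_derive x 1 (fun y => g (x0 + s * y)) (s * dg).
Proof.
move=> gd; have ad : is_derive x 1 (fun y : R => x0 + s * y) s.
  rewrite -[X in is_derive _ _ _ X]add0r -[X in _ + X]mulr1.
  by apply: is_deriveD; exact: is_deriveZ.
rewrite mulrC.
exact: (is_derive1_comp (f := g) (g := fun y : R => x0 + s * y)).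
Qed.

Lemma bounded_derivatives_affine g (x0 s : R) : bounded_derivatives g ->
  bounded_derivatives (fun y => g (x0 + s * y)).
Proof.
move=> bg.
pose F n y := s ^+ n * derive1n n g (x0 + s * y).
have -> : (fun y => g (x0 + s * y)) = F 0%N.
  by apply/funext => y; rewrite /F expr0 mul1r.
apply: (@bounded_derivatives_chain F) => n; rewrite /F.
  move=> x; rewrite exprSr -mulrA; apply: is_deriveZ.
  exact/is_derive1_affine/bounded_derivatives_is_derive.
have [_ [M gM]] := bg n; exists (`|s ^+ n| * M) => x.
by rewrite normrM ler_wpM2l.
Qed.

Lemma derive1_affine g (x0 s : R) : bounded_derivatives g ->
  derive1 (fun y => g (x0 + s * y)) = (fun y => s * (derive1 g) (x0 + s * y)).
Proof.
move=> bg; apply/funext => y; rewrite derive1E; apply: derive_val.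
exact/is_derive1_affine/(bounded_derivatives_is_derive bg 0).
Qed.

End smooth.

(** * Integrals of translates *)

Section L1.
Context {R : realType}.
Local Notation mu := (@lebesgue_measure R).
Implicit Types (f g : R -> R) (A B : set R).

Lemma L1Z A (c : R) f : measurable A -> L1 A f -> L1 A (fun x => c * f x).
Proof.
move=> mA intf; rewrite /L1.
exact: (@integrableZl _ _ _ mu A mA c (EFin \o f) intf).
Qed.

Lemma L1_norm A f : L1 A f -> L1 A (fun x => `|f x|).
Proof. by move=> intf; exact: (integrable_norm intf). Qed.

Lemma L1_measurable A f : L1 A f -> measurable_fun A f.
Proof. by move=> /integrableP[/measurable_EFinP]. Qed.

Lemma L1D A f g : measurable A -> L1 A f -> L1 A g ->
  L1 A (fun x => f x + g x).
Proof. by move=> mA intf intg; exact: (@integrableD _ _ _ mu A mA _ _ intf intg). Qed.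

Lemma L1B A f g : measurable A -> L1 A f -> L1 A g ->
  L1 A (fun x => f x - g x).
Proof. by move=> mA intf intg; exact: (@integrableB _ _ _ mu A mA _ _ intf intg). Qed.

Lemma L1_sub A B f : measurable A -> measurable B -> A `<=` B ->
  L1 B f -> L1 A f.
Proof. by move=> mA mB AB; exact: (@integrableS _ _ _ mu B A _ mB mA AB). Qed.

Lemma L1_le_norm A f : measurable A -> L1 A f ->
  `|\int[mu]_(x in A) f x| <= \int[mu]_(x in A) `|f x|.
Proof. by move=> mA; exact: (@le_normr_Rintegral _ _ _ mu A f mA). Qed.

Lemma L1_le A f g : measurable A -> L1 A f -> L1 A g ->
  (forall x, A x -> f x <= g x) ->
  \int[mu]_(x in A) f x <= \int[mu]_(x in A) g x.
Proof. by move=> mA; exact: (@le_Rintegral _ _ _ mu A f g mA). Qed.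

Lemma L1_RintegralZ A (c : R) f : measurable A -> L1 A f ->
  \int[mu]_(x in A) (c * f x) = c * \int[mu]_(x in A) f x.
Proof. by move=> mA; exact: (@RintegralZl _ _ _ mu A f c mA). Qed.

Lemma L1_RintegralB A f g : measurable A -> L1 A f -> L1 A g ->
  \int[mu]_(x in A) (f x - g x) =
  \int[mu]_(x in A) f x - \int[mu]_(x in A) g x.
Proof. by move=> mA; exact: (@RintegralB _ _ _ mu A f g mA). Qed.

Lemma L1_EFin A f : measurable A -> L1 A f ->
  (\int[mu]_(x in A) (f x)%:E = (\int[mu]_(x in A) f x)%R%:E)%E.
Proof.
move=> mA intf; rewrite /Rintegral fineK//.
exact: (@integrable_fin_num _ _ _ mu A mA _ intf).
Qed.

End L1.

(** * Differentiation under the integral sign *)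

Section aconv.
Context {R : realType}.
Local Notation mu := (@lebesgue_measure R).
Implicit Types (f g k phi : R -> R) (A B : set R).

(* Mollification is the case [s = -1]; fractional integrals of test functions
   are the case of [k] a power and [s] a sign. *)
Definition aconv k B (s : R) g x := \int[mu]_(y in B) (k y * g (x + s * y)).

Lemma integrable_mul_bounded A f g (M : R) : measurable A ->
  L1 A f -> measurable_fun A g -> (forall x, A x -> `|g x| <= M) ->
  L1 A (fun x => f x * g x).
Proof.
move=> mA intf mg gM.
have /integrableP[/measurable_EFinP mf _] := intf.
rewrite /L1; apply: (@le_integrable _ _ _ mu A mA _ (fun x => (M * f x)%:E)) => //.
- by apply/measurable_EFinP; exact: measurable_funM.
- move=> x Ax /=; rewrite lee_fin !normrM mulrC ler_wpM2r//.
  by rewrite (le_trans (gM _ Ax))// ler_norm.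
- exact: L1Z.
Qed.

Lemma integrable_mul_affine A f g (x0 s : R) : measurable A ->
  L1 A f -> continuous g -> (exists M, forall x, `|g x| <= M) ->
  L1 A (fun x => f x * g (x0 + s * x)).
Proof.
move=> mA intf cg [M gM]; apply: (integrable_mul_bounded (M := M)) => //.
apply: measurable_funTS; apply: measurableT_comp.
  exact: continuous_measurable_fun.
by apply: measurable_funD => //; exact: measurable_funM.
Qed.

Lemma bounded_aconv k B (s : R) g : measurable B -> L1 B k ->
  continuous g -> (exists M, forall x, `|g x| <= M) ->
  exists M, forall x, `|aconv k B s g x| <= M.
Proof.
move=> mB ik cg [M gM]; exists (\int[mu]_(y in B) (M * `|k y|)) => x.
have ikg : L1 B (fun y => k y * g (x + s * y)).
  by apply: integrable_mul_affine => //; exists M.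
rewrite /aconv (le_trans (L1_le_norm mB ikg))//.
apply: L1_le => //.
- exact: L1_norm.
- by apply: L1Z => //; exact: L1_norm.
- by move=> y _; rewrite normrM mulrC ler_wpM2r.
Qed.

(** The variable x occurs only in the factor [g], so the x-derivative of the integrand is dominated
    by M * |k y|, with M a bound of g'. This is integrable even when [k] is singular. *)
Lemma is_derive_aconv k B (s : R) g : measurable B -> L1 B k ->
  bounded_derivatives g ->
  forall x : R, is_derive x 1 (aconv k B s g) (aconv k B s (derive1 g) x).
Proof.
move=> mB ik bg x.
have cg := bounded_derivatives_continuous bg.
have [_ [M dgM]] := bg 1%N.
have dF y (z : R) : is_derive z 1 (fun x => k y * g (x + s * y))
    (k y * (derive1 g) (z + s * y)).
  apply: is_deriveZ.
  have -> : (fun x => g (x + s * y)) = (fun x => g (s * y + 1 * x)).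
    by apply/funext => w; rewrite mul1r addrC.
  rewrite -[X in is_derive _ _ _ X]mul1r; apply: is_derive1_affine.
  rewrite mul1r addrC; exact: (bounded_derivatives_is_derive bg 0).
pose F x y := k y * g (x + s * y).
have h1 : `]x - 1, x + 1[%classic x by rewrite /= in_itv/= ltrBlDr ltrDl ltr01.
have h2 (z : R) : `]x - 1, x + 1[%classic z ->
    mu.-integrable B (EFin \o (fun y => k y * g (z + s * y))).
  by move=> _; apply: integrable_mul_affine => //; exact: bounded_derivatives_bound.
have h3 (z y : R) : `]x - 1, x + 1[%classic z -> B y ->
    derivable (fun x => k y * g (x + s * y)) z 1.
  by move=> _ _; case: (dF y z).
have h4 : mu.-integrable B (EFin \o (fun y => M * `|k y|)).
  by apply: L1Z => //; exact: L1_norm.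
have M0 : 0 <= M by rewrite (le_trans _ (dgM 0)).
have h5 y : 0 <= M * `|k y| by rewrite mulr_ge0.
have h6 (z y : R) : `]x - 1, x + 1[%classic z -> B y ->
    `|partial1of2 (fun x y => k y * g (x + s * y)) z y| <= M * `|k y|.
  move=> _ _; rewrite /partial1of2 derive1E.
  have := dF y z => /(@derive_val _ _ _ _ _ _ _) ->.
  by rewrite normrM mulrC ler_wpM2r// dgM.
have der := (@derivable_under_integral R _ _ mu F B mB x (x - 1) (x + 1)
  h1 h2 h3 (fun y => M * `|k y|) h5 h4 h6).
have val := (@differentiation_under_integral R _ _ mu F B mB x (x - 1) (x + 1)
  h1 h2 h3 (fun y => M * `|k y|) h5 h4 h6).
apply: DeriveDef; first exact: der.
rewrite -derive1E val; apply: eq_Rintegral => y _.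
rewrite /partial1of2 derive1E.
by have := dF y x => /(@derive_val _ _ _ _ _ _ _) ->.
Qed.

Lemma bounded_derivatives_aconv k B (s : R) g : measurable B -> L1 B k ->
  bounded_derivatives g -> bounded_derivatives (aconv k B s g).
Proof.
move=> mB ik bg.
have bgn n : bounded_derivatives (derive1n n g).
  elim: n => [//|n IH]; rewrite derive1nS; exact: bounded_derivatives_derive1.
apply: (@bounded_derivatives_chain _ (fun n => aconv k B s (derive1n n g))).
  by move=> n x; exact: is_derive_aconv.
move=> n; apply: bounded_aconv => //.
  exact: bounded_derivatives_continuous.
exact: bounded_derivatives_bound.
Qed.

End aconv.

(** * Exchange of integrals *)

Section fubini.
Context {R : realType}.
Local Notation mu := (@lebesgue_measure R).
Implicit Types (f g k phi : R -> R) (A B : set R).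

Lemma L1_restrict A f : measurable A -> L1 A f -> L1 setT (f \_ A).
Proof.
move=> mA intf; rewrite /L1 -restrict_EFin.
exact: (@integrable_mkcond _ _ _ mu A (EFin \o f) mA).1.
Qed.

Lemma L1_measurable_EFin A f : L1 A f ->
  measurable_fun A (fun x => (f x)%:E).
Proof. by move=> /integrableP[]. Qed.

(** The integrand f x * k y * g (x + s * y) is dominated by M * |f x| * |k y|, a product of
    integrable functions of one variable each, hence it is integrable on the product. Restricting
    [f] to [A] and [k] to [B] by zero brings everything to the whole plane. *)
Lemma Fubini_aconv A B f k (s : R) g : measurable A -> measurable B ->
  L1 A f -> L1 B k -> continuous g -> (exists M, forall x, `|g x| <= M) ->
  \int[mu]_(x in A) (f x * aconv k B s g x) =
  \int[mu]_(y in B) (k y * \int[mu]_(x in A) (f x * g (x + s * y))).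
Proof.
move=> mA mB intf intk cg [M gM].
have M0 : 0 <= M by rewrite (le_trans _ (gM 0)).
have intfA := L1_restrict mA intf.
have intkB := L1_restrict mB intk.
pose F (z : R * R) := (f \_ A) z.1 * ((k \_ B) z.2 * g (z.1 + s * z.2)).
have mF : measurable_fun setT F.
  apply: measurable_funM.
    apply: measurableT_comp; last exact: measurable_fst.
    exact: L1_measurable intfA.
  apply: measurable_funM.
    apply: measurableT_comp; last exact: measurable_snd.
    exact: L1_measurable intkB.
  apply: measurableT_comp; first exact: continuous_measurable_fun.
  apply: measurable_funD; first exact: measurable_fst.
  by apply: measurable_funM => //; exact: measurable_snd.
have mEF : measurable_fun setT (EFin \o F) by exact/measurable_EFinP.
have intF : (mu \x mu)%E.-integrable setT (EFin \o F).
  apply/(@integrable12ltyP _ _ _ _ R mu mu _ mEF).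
  pose C := \int[mu]_y (M * `|(k \_ B) y|).
  have intMk : L1 setT (fun y => M * `|(k \_ B) y|).
    by apply: L1Z => //; exact: L1_norm.
  apply: (@le_lt_trans _ _ (\int[mu]_x (C * `|(f \_ A) x|)%:E)%E).
    apply: ge0_le_integral => //.
    - by move=> x _; exact: integral_ge0.
    - apply: (@measurable_fun_fubini_tonelli_F _ _ _ _ R mu (abse \o (EFin \o F))) => //=.
        exact: measurableT_comp.
    - apply: (L1_measurable_EFin (f := fun x => C * `|(f \_ A) x|)).
      by apply: L1Z => //; exact: L1_norm.
    - move=> x _.
      have -> : (C * `|(f \_ A) x|)%:E =
          (\int[mu]_y (`|(f \_ A) x| * (M * `|(k \_ B) y|))%:E)%E.
        rewrite L1_EFin//; last exact: L1Z.
        by rewrite L1_RintegralZ// mulrC.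
      apply: ge0_le_integral => //.
      + apply: measurableT_comp => //; apply: measurableT_comp => //.
      + apply: (L1_measurable_EFin
          (f := fun y => `|(f \_ A) x| * (M * `|(k \_ B) y|))).
        exact: L1Z.
      + move=> y _; rewrite /F /= lee_fin !normrM ler_wpM2l//.
        by rewrite mulrC ler_wpM2r.
  rewrite L1_EFin ?ltry//.
  by apply: L1Z => //; exact: L1_norm.
have := @Fubini _ _ _ _ R mu mu _ intF.
have -> : (fun x => \int[mu]_y (EFin \o F) (x, y))%E =
    (fun x => (((fun x => f x * aconv k B s g x) \_ A) x)%:E).
  apply/funext => x; rewrite /F/=.
  have intkg : L1 setT (fun y => (k \_ B) y * g (x + s * y)).
    by apply: integrable_mul_affine => //; exists M.
  rewrite L1_EFin//; last exact: L1Z.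
  rewrite L1_RintegralZ//; congr EFin.
  rewrite patchE; case: ifPn => xA; last by rewrite patchE (negbTE xA) mul0r.
  rewrite patchE xA /aconv [in RHS]Rintegral_mkcond; congr (_ * _).
  by apply: eq_Rintegral => y _; rewrite !patchE; case: ifPn => //; rewrite mul0r.
have -> : (fun y => \int[mu]_x (EFin \o F) (x, y))%E =
    (fun y => (((fun y => k y * \int[mu]_(x in A) (f x * g (x + s * y))) \_ B) y)%:E).
  apply/funext => y; rewrite /F/=.
  have intfg : L1 setT (fun x => (f \_ A) x * g (s * y + 1 * x)).
    by apply: integrable_mul_affine => //; exists M.
  have E x : (f \_ A) x * ((k \_ B) y * g (x + s * y)) =
      (k \_ B) y * ((f \_ A) x * g (s * y + 1 * x)).
    by rewrite mulrCA mul1r (addrC x).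
  under eq_integral do rewrite E.
  rewrite L1_EFin//; last exact: L1Z.
  rewrite L1_RintegralZ//; congr EFin.
  rewrite patchE; case: ifPn => yB; last by rewrite patchE (negbTE yB) mul0r.
  rewrite patchE yB [in RHS]Rintegral_mkcond; congr (_ * _).
  apply: eq_Rintegral => x _; rewrite !patchE mul1r (addrC (s * y)).
  by case: ifPn => //; rewrite mul0r.
move=> E; rewrite [LHS]Rintegral_mkcond [RHS]Rintegral_mkcond /Rintegral.
by rewrite E.
Qed.

End fubini.

(** * Translations and reflections of the line *)

Section affine.
Context {R : realType}.
Local Notation mu := (@lebesgue_measure R).

Let mR := measurableTypeR R.

Let affine (x0 e : R) : mR -> mR := fun y => x0 + e * y.

Let measurable_affine (x0 e : R) : measurable_fun setT (affine x0 e).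
Proof. by apply: measurable_funD => //; exact: measurable_funM. Qed.

(** By uniqueness of Lebesgue measure it is enough to compare lengths of intervals open on the left
    and closed on the right. A reflection exchanges the open and the closed end, which leaves the
    length unchanged. *)
Lemma lebesgue_measure_affine (x0 e : R) (A : set R) :
  e = 1 \/ e = -1 -> measurable A ->
  pushforward mu (affine x0 e) A = mu A.
Proof.
move=> he mA.
have mmix := isMeasurableFun.Build _ _ _ _ _ (measurable_affine x0 e).
pose phi : {mfun mR >-> mR} := HB.pack (affine x0 e) mmix.
suff : pushforward mu phi A = mu A by [].
apply/esym/lebesgue_measure_unique => //= _ [[a b]] _ <-.
rewrite /pushforward /=.
case: he => ->.
- have -> : affine x0 1 @^-1` `]a, b] = `]a - x0, b - x0]%classic.
    apply/seteqP; split => y /=; rewrite /affine !in_itv/= mul1r ltrBlDl lerBrDl//.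
  rewrite !lebesgue_measure_itv/= !lte_fin ltrD2r; case: ifPn => // _.
  by rewrite -!EFinB; congr EFin; ring.
- have -> : affine x0 (-1) @^-1` `]a, b] = `[x0 - b, x0 - a[%classic.
    apply/seteqP; split => y /=; rewrite /affine !in_itv/= mulN1r.
      by move=> /andP[h1 h2]; apply/andP; split; lra.
    by move=> /andP[h1 h2]; apply/andP; split; lra.
  rewrite !lebesgue_measure_itv/= !lte_fin ltrD2l ltrN2; case: ifPn => // _.
  by rewrite -!EFinB; congr EFin; ring.
Qed.

Lemma ge0_integral_affine (x0 e : R) (f : R -> \bar R) :
  e = 1 \/ e = -1 -> measurable_fun setT f -> (forall x, 0 <= f x)%E ->
  (\int[mu]_y f (x0 + e * y)%R = \int[mu]_y f y)%E.
Proof.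
move=> he mf f0.
have := @ge0_integral_pushforward _ _ mR mR R (affine x0 e)
  (measurable_affine x0 e) mu setT f measurableT mf (fun y _ => f0 y).
rewrite preimage_setT /affine /= => <-.
apply: eq_measure_integral; first exact: measurable_affine.
by move=> mphi A mA _; exact: (lebesgue_measure_affine x0 he mA).
Qed.

Lemma Rintegral_affine (x0 e : R) (f : R -> R) :
  e = 1 \/ e = -1 -> measurable_fun setT f ->
  \int[mu]_y f (x0 + e * y) = \int[mu]_y f y.
Proof.
move=> he mf.
have mEf : measurable_fun setT (EFin \o f) by exact/measurable_EFinP.
rewrite /Rintegral integralE [in RHS]integralE; congr (fine (_ - _)).
- rewrite -[RHS](@ge0_integral_affine x0 e ((EFin \o f)^\+)%E he).
  + by apply: eq_integral => y _; rewrite !funeposE.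
  + exact: measurable_funepos.
  + by move=> y; exact: funepos_ge0.
- rewrite -[RHS](@ge0_integral_affine x0 e ((EFin \o f)^\-)%E he).
  + by apply: eq_integral => y _; rewrite !funenegE.
  + exact: measurable_funeneg.
  + by move=> y; exact: funeneg_ge0.
Qed.

End affine.

(** * The kernel of the fractional integral *)

Section kernel.
Context {R : realType}.
Local Notation mu := (@lebesgue_measure R).
Variable alpha : R.

(** Written as an inverse to match the quotient in [frac_int] of order 1 - alpha, whose exponent 1 -
    (1 - alpha) is alpha. *)
Definition rl_kernel (t : R) : R := (t `^ alpha)^-1.

Lemma measurable_rl_kernel (A : set R) : measurable_fun A rl_kernel.
Proof.
apply: measurable_funTS.
have -> : rl_kernel = (@powR R ^~ (- alpha)).
  by apply/funext => t; rewrite /rl_kernel powRN.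
exact: measurable_powR.
Qed.

(** The singularity is approached by closed intervals away from 0, where the fundamental theorem of
    calculus applies with the primitive [P]. The integrals stay below [P L], since [P] is
    nonnegative, and monotone convergence concludes. *)
Lemma L1_rl_kernel (L : R) : alpha < 1 -> 0 < L -> L1 `]0, L[ rl_kernel.
Proof.
move=> ha1 L0; apply/integrableP; split.
  by apply/measurable_EFinP; exact: measurable_rl_kernel.
have kE : rl_kernel = (@powR R ^~ (- alpha)).
  by apply/funext => t; rewrite /rl_kernel powRN.
have a1 : 0 < 1 - alpha by rewrite subr_gt0.
pose P (t : R) := (1 - alpha)^-1 * t `^ (1 - alpha).
have dP (t : R) : 0 < t -> is_derive t 1 P (rl_kernel t).
  move=> t0; have dp := is_derive1_powR (1 - alpha) t0.
  have -> : rl_kernel t =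
      (1 - alpha)^-1 *: ((1 - alpha) * t `^ (1 - alpha - 1)).
    rewrite kE /= [_ *: _]mulrA mulVf ?gt_eqF// mul1r; congr (_ `^ _); ring.
  exact: is_deriveZ.
have k0 (t : R) : 0 <= rl_kernel t by rewrite invr_ge0 powR_ge0.
have ck (t : R) : 0 < t -> {for t, continuous rl_kernel}.
  move=> t0; rewrite kE; apply/differentiable_continuous/derivable1_diffP.
  by have [] := is_derive1_powR (- alpha) t0.
have cP (t : R) : 0 < t -> {for t, continuous P}.
  move=> t0; apply/differentiable_continuous/derivable1_diffP.
  by have [] := dP t t0.
(* Dividing by i + 2 rather than i + 1 keeps the interval nondegenerate already for i = 0. *)
pose F (i : nat) := `[L / i.+2%:R, L]%classic : set R.
have F0 i : 0 < L / i.+2%:R :> R by rewrite divr_gt0.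
have FL i : L / i.+2%:R < L :> R.
  by rewrite ltr_pdivrMr// ltr_pMr// ltr1n.
have intF i : (\int[mu]_(x in F i) (rl_kernel x)%:E =
    (P L)%:E - (P (L / i.+2%:R))%:E)%E.
  apply: continuous_FTC2 => //.
  - apply: continuous_in_subspaceT => t; rewrite inE/= in_itv/= => /andP[t0 _].
    by apply: ck; exact: lt_le_trans t0.
  - split => //=.
    + move=> t; rewrite in_itv/= => /andP[t0 _].
      by have [] := dP t (lt_trans (F0 i) t0).
    + apply: cvg_at_right_filter; exact: cP.
    + apply: cvg_at_left_filter; exact: cP.
  - move=> t; rewrite in_itv/= => /andP[t0 _].
    by rewrite derive1E; have [_ ->] := dP t (lt_trans (F0 i) t0).
have FE : `]0, L[%classic `<=` \bigcup_i F i.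
  move=> t /=; rewrite in_itv/= => /andP[t0 tL].
  (* With n the integer part of L / t one has L / t < n + 1 <= n + 2, so L / (n + 2) <= t. *)
  exists (Num.truncn (L / t)) => //=; rewrite /F/= in_itv/= (ltW tL) andbT.
  rewrite ler_pdivrMr// mulrC -ler_pdivrMr// ltW// (lt_le_trans (truncnS_gt _))//.
  by rewrite ler_nat.
have mF i : measurable (F i) by exact: measurable_itv.
have ndF : nondecreasing_seq F.
  move=> i j ij; rewrite subsetEset => t; rewrite /F/= !in_itv/= => /andP[h ->].
  rewrite andbT (le_trans _ h)// ler_pM2l// lef_pV2 ?posrE// ler_nat.
  by rewrite !ltnS.
have mk i : measurable_fun (F i) (EFin \o rl_kernel).
  by apply/measurable_EFinP; exact: measurable_rl_kernel.
have k0' i x : F i x -> (0 <= (EFin \o rl_kernel) x)%E.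
  by rewrite lee_fin.
have cvgF := @ge0_nondecreasing_set_cvg_integral _ (measurableTypeR R) R F (EFin \o rl_kernel) mu
  ndF mF mk k0'.
apply: (@le_lt_trans _ _ (P L)%:E); last exact: ltry.
apply: (@le_trans _ _ (\int[mu]_(x in \bigcup_i F i) (rl_kernel x)%:E)%E).
  under eq_integral => x _ do rewrite /= ger0_norm//.
  apply: ge0_subset_integral => //.
  - by apply: bigcupT_measurable => i; exact: mF.
  - by apply/measurable_EFinP; exact: measurable_rl_kernel.
  - by move=> x _; rewrite lee_fin.
change (\int[mu]_(x in \bigcup_i F i) (EFin \o rl_kernel) x <= (P L)%:E)%E.
rewrite -(cvg_lim _ cvgF)//; apply: lime_le.
  by apply/cvg_ex; eexists; exact: cvgF.
apply: nearW => i; rewrite intF -EFinB lee_fin gerBl /P.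
by rewrite mulr_ge0 ?invr_ge0 ?powR_ge0// ltW.
Qed.

End kernel.

(** * Smooth bump functions *)

Section bump.
Context {R : realType}.
Local Notation mu := (@lebesgue_measure R).
Implicit Types (p q : {poly R}) (x y a b : R).

(** Monomial by monomial, y^i <= i! * e^y, by the exponential series; this gives the constant. *)
Lemma poly_le_expR p : exists C, forall y, 0 < y -> `|p.[y]| <= C * expR y.
Proof.
exists (\sum_(i < size p) `|p`_i| * (i`!)%:R) => y y0.
rewrite horner_coef (le_trans (ler_norm_sum _ _ _))// mulr_suml.
apply: ler_sum => i _; rewrite normrM -mulrA ler_wpM2l//.
rewrite ger0_norm; last by rewrite exprn_ge0// ltW.
rewrite mulrC -ler_pdivrMr ?ltr0n ?fact_gt0//.
have [->|i0] := eqVneq (i : nat) 0%N.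
  by rewrite expr0 fact0 divr1 -expR0 ler_expR ltW.
apply: le_trans (expR_ge1Dxn i.-1 (ltW y0)).
by rewrite prednK ?lt0n// lerDr.
Qed.

(* This family, and hence the sums [bump_sum] below, is stable under
   differentiation, which yields the smoothness of the bump function. *)
Definition flat p x := if 0 < x then p.[x^-1] * expR (- x^-1) else 0.

Lemma flat_bounded p : exists C, forall x, `|flat p x| <= C.
Proof.
have [C pC] := poly_le_expR p.
have C0 : 0 <= C.
  have := le_trans (normr_ge0 _) (pC 1 ltr01).
  by rewrite pmulr_lge0// expR_gt0.
exists C => x; rewrite /flat; case: ifPn => x0; last by rewrite normr0.
rewrite normrM (ger0_norm (expR_ge0 _)) expRN ler_pdivrMr ?expR_gt0//.
by apply: pC; rewrite invr_gt0.
Qed.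

(** The chain rule at y = 1/x: the derivative of p(1/x) e^(-1/x) is y^2 (p(y) - p'(y)) e^(-y). *)
Definition flat_deriv p := ('X ^+ 2 * (p - p^`()))%R.

(** Extracts a power of x at the price of a higher degree. Used twice, it makes the difference
    quotient of [flat p] at 0 equal to h times a bounded function of h. *)
Lemma flatXE p x : x != 0 -> flat p x = x * flat ('X * p) x.
Proof.
move=> x0; rewrite /flat; case: ifPn => _; last by rewrite mulr0.
by rewrite hornerM hornerX !mulrA divff// mul1r.
Qed.

Lemma flat_is_derive p (x : R) : is_derive x 1 (flat p) (flat (flat_deriv p) x).
Proof.
have [x0|x0|x0] := ltgtP x 0.
- rewrite [X in is_derive _ _ _ X]/flat (lt_gtF x0).
  apply: (@near_eq_is_derive _ _ _ (cst 0)).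
  near=> y; rewrite /flat lt_gtF//; near: y; exact: lt_nbhsl.
- have nr : \near x, p.[x^-1] * expR (- x^-1) = flat p x.
    near=> y; rewrite /flat ifT//; near: y; exact: lt_nbhsr.
  apply: (@near_eq_is_derive _ _ _ _ _ _ _ _ nr).
  rewrite [X in is_derive _ _ _ X]/flat x0.
  have x1 : x != 0 by rewrite gt_eqF.
  have dV : is_derive x 1 (fun y : R => y^-1) (- (x^-1) ^+ 2).
    by rewrite -[X in is_derive _ _ _ X]mulr1 exprVn; exact: is_deriveV.
  have dp : is_derive x 1 (fun y => p.[y^-1]) (p^`().[x^-1] * - (x^-1) ^+ 2).
    exact: (@is_derive1_comp _ (horner p) (fun y => y^-1)).
  have dE : is_derive x 1 (fun y => expR (- y^-1))
      (expR (- x^-1) * - - (x^-1) ^+ 2).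
    exact: (@is_derive1_comp _ expR (fun y => - y^-1)).
  apply: (is_derive_eq (is_deriveM dp dE)).
  by rewrite /flat_deriv !hornerE /= /GRing.scale/=; ring.
- rewrite x0 [X in is_derive _ _ _ X]/flat ltxx.
  have [C hC] := flat_bounded ('X * ('X * p)).
  have C0 : 0 <= C := le_trans (normr_ge0 _) (hC 0).
  have lim : h^-1 *: (flat p (h *: 1 + 0) - flat p 0) @[h --> 0^'] --> (0 : R).
    apply/cvgr0Pnorm_le => e e0.
    near=> h.
    have h0 : h != 0 by near: h; exact: nbhs_dnbhs_neq.
    rewrite [h *: 1]mulr1 addr0 {2}/flat ltxx subr0 (flatXE _ h0) (flatXE _ h0).
    rewrite [_ *: _]mulrA mulVf// mul1r normrM.
    rewrite (le_trans (ler_wpM2l (normr_ge0 _) (hC h)))//.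
    (* [C] may be 0, and C + 1 can safely be divided by. *)
    rewrite (@le_trans _ _ (`|h| * (C + 1)))//.
      by rewrite ler_wpM2l// lerDl.
    rewrite -ler_pdivlMr ?ltr_wpDl//; near: h.
    apply: dnbhs0_le; rewrite divr_gt0// ltr_wpDl//.
  have dv : derivable (flat p) 0 1 by apply/cvg_ex; exists 0.
  by apply: DeriveDef => //; exact: cvg_lim lim.
Unshelve. all: by end_near. Qed.

Definition bump_sum a b (l : seq ({poly R} * {poly R})) x :=
  \sum_(r <- l) flat r.1 (x - a) * flat r.2 (b - x).

(** The product rule on lists of pairs of polynomials. The minus sign in the second half comes from
    the reflected argument b - x. *)
Definition bump_deriv (l : seq ({poly R} * {poly R})) :=
  [seq (flat_deriv r.1, r.2) | r <- l] ++
  [seq (r.1, - flat_deriv r.2) | r <- l].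

Lemma flatN p x : flat (- p) x = - flat p x.
Proof. by rewrite /flat; case: ifPn => _; rewrite ?oppr0// hornerN mulNr. Qed.

Lemma bump_sum_is_derive a b l (x : R) :
  is_derive x 1 (bump_sum a b l) (bump_sum a b (bump_deriv l) x).
Proof.
rewrite {2}/bump_sum big_cat !big_map /= -big_split /=.
rewrite /bump_sum.
have -> : (fun x => \sum_(r <- l) flat r.1 (x - a) * flat r.2 (b - x)) =
    \sum_(r <- l) (fun x => flat r.1 (x - a) * flat r.2 (b - x)).
  by apply/funext => y; rewrite fct_sumE.
elim: l => [|[p q] l IH]; first by rewrite !big_nil; exact: is_derive_cst.
rewrite !big_cons /=.
suff D : is_derive x 1 (fun x => flat p (x - a) * flat q (b - x))
    (flat (flat_deriv p) (x - a) * flat q (b - x) +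
     flat p (x - a) * flat (- flat_deriv q) (b - x)) by exact: (is_deriveD D IH).
have d1 : is_derive x 1 (fun x => flat p (x - a)) (flat (flat_deriv p) (x - a)).
  have -> : (fun x => flat p (x - a)) = (fun x => flat p (- a + 1 * x)).
    by apply/funext => y; rewrite mul1r addrC.
  rewrite -[X in is_derive _ _ _ X]mul1r; apply: is_derive1_affine.
  by rewrite mul1r addrC; exact: flat_is_derive.
have d2 : is_derive x 1 (fun x => flat q (b - x)) (- flat (flat_deriv q) (b - x)).
  have -> : (fun x => flat q (b - x)) = (fun x => flat q (b + (-1) * x)).
    by apply/funext => y; rewrite mulN1r.
  rewrite -[X in is_derive _ _ _ X]mulN1r; apply: is_derive1_affine.
  by rewrite mulN1r; exact: flat_is_derive.
apply: (is_derive_eq (is_deriveM d1 d2)).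
by rewrite flatN /GRing.scale/= addrC mulrC.
Qed.

Lemma bump_sum_bounded a b l : exists C, forall x, `|bump_sum a b l x| <= C.
Proof.
elim: l => [|[p q] l [C hC]].
  by exists 0 => x; rewrite /bump_sum big_nil normr0.
have [C1 h1] := flat_bounded p; have [C2 h2] := flat_bounded q.
exists (C1 * C2 + C) => x; rewrite /bump_sum big_cons (le_trans (ler_normD _ _))//.
apply: lerD; last exact: hC.
by rewrite normrM ler_pM.
Qed.

Lemma bounded_derivatives_bump a b :
  bounded_derivatives (fun x => flat 1 (x - a) * flat 1 (b - x)).
Proof.
have -> : (fun x => flat 1 (x - a) * flat 1 (b - x)) =
    (fun n => bump_sum a b (iter n bump_deriv [:: (1, 1)])) 0%N.
  by apply/funext => x; rewrite /bump_sum /= big_seq1.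
apply: (@bounded_derivatives_chain _
  (fun n => bump_sum a b (iter n bump_deriv [:: (1, 1)]))).
  by move=> n x; exact: bump_sum_is_derive.
by move=> n; exact: bump_sum_bounded.
Qed.

Lemma flat1_ge0 x : 0 <= flat 1 x.
Proof. by rewrite /flat; case: ifPn => // _; rewrite hornerC mul1r expR_ge0. Qed.

Lemma le_flat1 x y : 0 < x -> x <= y -> flat 1 x <= flat 1 y.
Proof.
move=> x0 xy; have y0 := lt_le_trans x0 xy.
by rewrite /flat x0 y0 !hornerC !mul1r ler_expR lerN2 lef_pV2.
Qed.

Lemma L1_support a b (f : R -> R) : continuous f ->
  (forall x, ~~ (a < x < b) -> f x = 0) -> L1 setT f.
Proof.
move=> cf f0.
have -> : f = f \_ `[a, b].
  apply/funext => x; rewrite patchE; case: ifPn => //.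
  rewrite notin_setE /= in_itv/= => /negP xab; apply: f0.
  by apply: contra xab => /andP[/ltW -> /ltW ->].
apply: L1_restrict => //.
apply: continuous_compact_integrable; first exact: segment_compact.
exact: continuous_subspaceT.
Qed.

Lemma mollifier a b : a < b -> exists eta : R -> R,
  [/\ bounded_derivatives eta, forall x, 0 <= eta x,
      forall x, ~~ (a < x < b) -> eta x = 0 &
      \int[mu]_x eta x = 1].
Proof.
move=> ab.
pose rho x := flat 1 (x - a) * flat 1 (b - x).
have brho : bounded_derivatives rho by exact: bounded_derivatives_bump.
have rho0 x : 0 <= rho x by rewrite mulr_ge0 ?flat1_ge0.
have rhoS x : ~~ (a < x < b) -> rho x = 0.
  rewrite negb_and -!leNgt /rho /flat => /orP[xa|bx].
    by rewrite subr_gt0 ltNge xa mul0r.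
  by rewrite [X in _ * (if X then _ else _)]subr_gt0 (ltNge x) bx mulr0.
have L1rho : L1 setT rho.
  exact: (L1_support (bounded_derivatives_continuous brho) rhoS).
(* On [a + w, b - w], of length (b - a) / 2, both x - a and b - x are at least [w]; as [flat 1]
   increases on positive arguments, [rho] is at least [c] there, so its integral is positive. *)
pose w := (b - a) / 4.
have w0 : 0 < w by rewrite divr_gt0// subr_gt0.
pose c := flat 1 w * flat 1 w.
have c0 : 0 < c by rewrite /c /flat w0 hornerC mul1r mulr_gt0 ?expR_gt0.
pose A := `[a + w, b - w]%classic : set R.
have mA : measurable A by exact: measurable_itv.
have wab : a + w < b - w by rewrite /w; lra.
have I0 : 0 < \int[mu]_x rho x.
  apply: (@lt_le_trans _ _ (\int[mu]_(x in A) c)).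
    rewrite Rintegral_cst// pmulr_rgt0// /A /= lebesgue_measure_itv/= lte_fin wab.
    by rewrite -EFinB /= subr_gt0.
  rewrite Rintegral_mkcond; apply: L1_le => //.
    apply: L1_restrict => //.
    apply: continuous_compact_integrable; first exact: segment_compact.
    exact/continuous_subspaceT/cst_continuous.
  move=> x _; rewrite patchE; case: ifPn => // /set_mem; rewrite /A/= in_itv/=.
  by move=> /andP[ax xb]; rewrite ler_pM ?flat1_ge0// le_flat1//; lra.
exists (fun x => (\int[mu]_x rho x)^-1 * rho x); split.
- exact: bounded_derivativesZ.
- by move=> x; rewrite mulr_ge0// invr_ge0 ltW.
- by move=> x /rhoS ->; rewrite mulr0.
- by rewrite L1_RintegralZ// mulVf// gt_eqF.
Qed.

End bump.

(** * Riemann-Liouville derivatives of test functions *)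

Section test_functions.
Context {R : realType}.
Local Notation mu := (@lebesgue_measure R).
Implicit Types (a b x : R) (phi g : R -> R).

Lemma derive1n_support phi x : ~ closure [set x | phi x != 0] x ->
  forall n, \near x, derive1n n phi x = 0.
Proof.
move=> Sx n.
(* The induction treats all points of the open complement of the support together, because a
   derivative at y depends on the values near y. *)
suff H : forall y, ~ closure [set x | phi x != 0] y -> derive1n n phi y = 0.
  have : open (~` closure [set x | phi x != 0]).
    by apply: closed_openC; exact: closed_closure.
  by rewrite openE => /(_ x Sx); apply: filterS.
elim: n => [y Sy|n IH y Sy].
  by apply: contra_notP Sy => /eqP Sy; exact: subset_closure.
rewrite derive1nS derive1E (near_eq_derive (g := cst 0)) ?derive_cst//.
have : open (~` closure [set x | phi x != 0]).
  by apply: closed_openC; exact: closed_closure.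
by rewrite openE => /(_ y Sy); apply: filterS => z; exact: IH.
Qed.

Section test.
Variables (a b : R) (phi : R -> R).
Hypotheses (ab : a < b) (tphi : test_function `]a, b[ phi).

Lemma test_function_eq0 n x : ~~ (a < x < b) -> derive1n n phi x = 0.
Proof.
move=> xab; apply: (@nbhs_singleton _ _ (fun x => derive1n n phi x = 0)).
apply: derive1n_support => Sx.
by have [_ _ /(_ x Sx)] := tphi; rewrite /= in_itv/= => h; rewrite h in xab.
Qed.

(** By definition a test function is smooth only on (a, b). Elsewhere it is smooth because a point
    off the closed support has a neighbourhood on which the function vanishes. The bound is a
    maximum over [a, b]. *)
Lemma test_function_bounded_derivatives : bounded_derivatives phi.
Proof.
have dphi n x : derivable (derive1n n phi) x 1.
  have [Sx|Sx] := pselect (closure [set x | phi x != 0] x).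
    by have [sphi _ sub] := tphi; apply: sphi; exact: sub.
  have nr := derive1n_support Sx n.
  by apply: (near_eq_derivable (f := cst 0)); first near do apply/esym.
move=> n; split=> [//|].
have cn : continuous (fun x => `|derive1n n phi x|).
  move=> x; apply: continuous_comp; last exact: norm_continuous.
  exact/differentiable_continuous/derivable1_diffP/dphi.
have [c _ cM] := EVT_max (ltW ab) (continuous_subspaceT cn).
exists `|derive1n n phi c| => x; have [xab|xab] := boolP (a < x < b).
  by apply: cM; rewrite in_itv/=; case/andP: xab => /ltW -> /ltW ->.
by rewrite test_function_eq0// normr0.
Unshelve. all: by end_near. Qed.

End test.

Lemma test_functionP a b (p q : R) g : a < p -> q < b ->
  bounded_derivatives g -> (forall x, ~~ (p < x < q) -> g x = 0) ->
  test_function `]a, b[ g.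
Proof.
move=> ap qb bg g0.
have sub : closure [set x | g x != 0] `<=` `[p, q].
  rewrite closureE => x; apply; split; first exact: interval_closed.
  move=> y /= gy; rewrite in_itv/=; apply/andP.
  have /andP[/ltW -> /ltW ->//] : p < y < q.
  by apply: contraNT gy => /g0 ->.
split.
- by move=> n x _; case: (bg n).
- apply: (subclosed_compact _ (@segment_compact _ p q)) => //.
  exact: closed_closure.
- apply: subset_trans sub _ => x /=; rewrite !in_itv/= => /andP[px xq].
  by rewrite (lt_le_trans ap px) (le_lt_trans xq qb).
Qed.

End test_functions.

(** * Riemann-Liouville derivatives with a fixed domain of integration *)

Section RL.
Context {R : realType}.
Local Notation mu := (@lebesgue_measure R).

(* The sign [e] such that the fractional integral of side [opposite s] at [x]
   integrates over the points [x + e * t], [t > 0]. *)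
Definition side_sign (s : side) : R := match s with Left => 1 | Right => -1 end.

Lemma side_signP s : side_sign s = 1 \/ side_sign s = -1.
Proof. by case: s => /=; [left|right]. Qed.

Variables (s : side) (a b alpha : R) (phi : R -> R).
Hypotheses (ab : a < b) (ha1 : alpha < 1).
Hypothesis tphi : test_function `]a, b[ phi.

(** Substituting y = z + e * t turns the moving domain into (0, b - z) or (0, z - a). Both extend to
    (0, b - a) at no cost, since [phi] vanishes outside (a, b). *)
Lemma frac_int_aconv (z : R) : a < z < b ->
  frac_int (opposite s) a b (1 - alpha) phi z =
  (Gamma (1 - alpha))^-1 *
    aconv (rl_kernel alpha) `]0, (b - a)[ (side_sign s) phi z.
Proof.
move=> /andP[az zb].
have aE : 1 - (1 - alpha) = alpha by ring.
have phi0 x : ~~ (a < x < b) -> phi x = 0 by exact: (test_function_eq0 tphi 0).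
have cphi : continuous phi.
  exact: bounded_derivatives_continuous (test_function_bounded_derivatives ab tphi).
have mphi : measurable_fun setT phi by exact: continuous_measurable_fun.
have mf (w e : R) : measurable_fun setT (fun y => phi y / (w + e * y) `^ alpha).
  apply: measurable_funM => //.
  apply: (@measurableT_comp _ _ _ _ _ _ (rl_kernel alpha)).
    exact: measurable_rl_kernel.
  by apply: measurable_funD => //; exact: measurable_funM.
rewrite /aconv; case: s => /=; rewrite aE; congr (_ * _).
- under eq_Rintegral do rewrite addrC -[X in _ + X]mul1r.
  rewrite Rintegral_mkcond [RHS]Rintegral_mkcond.
  pose F := (fun y => phi y / (- z + 1 * y) `^ alpha) \_ `]z, b[.
  have mF : measurable_fun setT F.
    apply/(measurable_restrictT _ (measurable_itv _)).
    exact: (measurable_funTS (mf (- z) 1)).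
  rewrite -[LHS](@Rintegral_affine _ z 1 F)//; last by left.
  apply: eq_Rintegral => t _; rewrite /F !patchE.
  have -> : - z + 1 * (z + 1 * t) = t by ring.
  rewrite mul1r !mem_setE !in_itv/= ltrDl.
  have [t0|t0] //= := boolP (0 < t); rewrite mulrC.
  have [tb|tb] := boolP (z + t < b); last first.
    rewrite phi0 ?mulr0 ?if_same//; apply: contra tb => /andP[_].
    by [].
  by rewrite ifT//; lra.
- under eq_Rintegral do rewrite -[X in z + X]mulN1r.
  rewrite Rintegral_mkcond [RHS]Rintegral_mkcond.
  pose F := (fun y => phi y / (z + -1 * y) `^ alpha) \_ `]a, z[.
  have mF : measurable_fun setT F.
    apply/(measurable_restrictT _ (measurable_itv _)).
    exact: (measurable_funTS (mf z (-1))).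
  rewrite -[LHS](@Rintegral_affine _ z (-1) F)//; last by right.
  apply: eq_Rintegral => t _; rewrite /F !patchE.
  have -> : z + -1 * (z + -1 * t) = t by ring.
  rewrite mulN1r !mem_setE !in_itv/= gtrDl oppr_lt0 andbC.
  have [t0|t0] //= := boolP (0 < t); rewrite mulrC.
  have [tb|tb] := boolP (a < z - t); last first.
    rewrite phi0 ?mulr0 ?if_same//; apply: contra tb => /andP[+ _].
    by [].
  by rewrite ifT//; lra.
Qed.

(** As the domain of integration no longer depends on x, differentiation reaches only [phi] and
    creates no boundary term. The sign - e is the one in the definition of [RL_deriv] on the
    opposite side. *)
Lemma RL_deriv_aconv (x : R) : a < x < b ->
  RL_deriv (opposite s) a b alpha phi x =
  - side_sign s * (Gamma (1 - alpha))^-1 *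
    aconv (rl_kernel alpha) `]0, (b - a)[ (side_sign s) (derive1 phi) x.
Proof.
move=> xab.
have bphi := test_function_bounded_derivatives ab tphi.
have L1k : L1 `]0, (b - a)[ (rl_kernel alpha).
  by apply: L1_rl_kernel => //; rewrite subr_gt0.
have mI : measurable (`]0, (b - a)[%classic : set R) by exact: measurable_itv.
have H : derive1 (frac_int (opposite s) a b (1 - alpha) phi) x =
  (Gamma (1 - alpha))^-1 *
    aconv (rl_kernel alpha) `]0, (b - a)[ (side_sign s) (derive1 phi) x.
  rewrite derive1E (near_eq_derive (g := fun z => (Gamma (1 - alpha))^-1 *
    aconv (rl_kernel alpha) `]0, (b - a)[ (side_sign s) phi z)).
    by apply: derive_val; apply: is_deriveZ; exact: is_derive_aconv.
  have : open (`]a, b[%classic : set R) by exact: interval_open.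
  rewrite openE => /(_ x); rewrite /interior /= in_itv/= => /(_ xab).
  by apply: filterS => z /=; rewrite in_itv/= => zab; exact: frac_int_aconv.
by move: H; case: s => /= ->; rewrite ?mulNr ?mul1r ?mulN1r ?opprK ?mulNr.
Qed.

End RL.

(** * Mollification in L^1 *)

Section mollification.
Context {R : realType}.
Local Notation mu := (@lebesgue_measure R).
Implicit Types (a b x : R) (f g h : R -> R).

Lemma continuous_L1_itv a b g : continuous g ->
  L1 `]a, b[ g.
Proof.
move=> cg; apply: (@L1_sub _ _ `[a, b]) => //.
  exact: subset_itv_oo_cc.
apply: continuous_compact_integrable; first exact: segment_compact.
exact: continuous_subspaceT.
Qed.

Lemma L1_Rintegral_subset A B f : measurable A -> measurable B -> A `<=` B ->
  L1 B f -> (forall x : R, 0 <= f x) ->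
  \int[mu]_(x in A) f x <= \int[mu]_(x in B) f x.
Proof.
move=> mA mB AB intf f0.
rewrite Rintegral_mkcond [leRHS]Rintegral_mkcond; apply: L1_le => //.
- by apply: L1_restrict => //; exact: (L1_sub mA mB).
- exact: L1_restrict.
- move=> x _; rewrite !patchE; case: ifPn => xA.
    by rewrite ifT//; apply/mem_set/AB/set_mem.
  by case: ifPn.
Qed.

Section one.
Variables (eta : R -> R) (delta : R).
Hypotheses (beta : bounded_derivatives eta) (eta0 : forall x, 0 <= eta x).
Hypothesis etaS : forall x, ~~ (`|x| < delta) -> eta x = 0.
Hypothesis eta1 : \int[mu]_x eta x = 1.

Let ceta := bounded_derivatives_continuous beta.
Let Beta := bounded_derivatives_bound beta.

Lemma L1_mollifier x0 e : e = 1 \/ e = -1 -> L1 setT (fun y => eta (x0 + e * y)).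
Proof.
move=> he; apply: (@L1_support _ (- (e * x0) - delta) (- (e * x0) + delta)).
  exact/bounded_derivatives_continuous/bounded_derivatives_affine.
move=> y ny; apply: etaS; apply: contra ny; rewrite ltr_norml.
by case: he => -> /andP[h1 h2]; apply/andP; split; lra.
Qed.

Lemma Rintegral_mollifier x0 e : e = 1 \/ e = -1 ->
  \int[mu]_y eta (x0 + e * y) = 1.
Proof.
move=> he; rewrite (@Rintegral_affine _ x0 e eta) //.
exact: continuous_measurable_fun.
Qed.

Lemma Rintegral_mollifier_le1 A x0 e : measurable A -> e = 1 \/ e = -1 ->
  \int[mu]_(y in A) eta (x0 + e * y) <= 1.
Proof.
move=> mA he; rewrite -(Rintegral_mollifier x0 he).
by apply: L1_Rintegral_subset => //; exact: L1_mollifier.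
Qed.

(** Up to a loss of mass near the boundary, mollification is an average of [h] over points within
    [delta] of x. This serves both for pointwise convergence, with h = g x - g, and for the
    domination, with h = g. *)
Lemma aconv_mollifier_bound A h M x : measurable A -> L1 A h -> 0 <= M ->
  (forall y, A y -> `|x - y| < delta -> `|h y| <= M) ->
  `|aconv h A (-1) eta x| <= M.
Proof.
move=> mA inth M0 hM.
have Lh : L1 A (fun y => h y * eta (x + -1 * y)) by exact: integrable_mul_affine.
have Le : L1 A (fun y => eta (x + -1 * y)).
  by apply: (L1_sub mA measurableT) => //; apply: L1_mollifier; right.
apply: (@le_trans _ _ (\int[mu]_(y in A) (M * eta (x + -1 * y)))).
  apply: le_trans (L1_le_norm mA Lh) _; apply: L1_le => //.
  - exact: L1_norm.
  - exact: L1Z.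
  - move=> y Ay; rewrite normrM (ger0_norm (eta0 _)).
    have [xy|xy] := boolP (`|x - y| < delta); first by rewrite ler_wpM2r// hM.
    by rewrite mulN1r etaS// !mulr0.
rewrite L1_RintegralZ// -[leRHS]mulr1 ler_wpM2l//.
by apply: Rintegral_mollifier_le1 => //; right.
Qed.

(** Young's inequality for a kernel of mass one: after Fubini, each |h y| is multiplied by the
    integral of eta (x - y) over x in (a, b), which is at most 1. *)
Lemma aconv_mollifier_L1 a b h : L1 `]a, b[ h ->
  \int[mu]_(x in `]a, b[) `|aconv h `]a, b[ (-1) eta x| <=
  \int[mu]_(x in `]a, b[) `|h x|.
Proof.
set A := `]a, b[%classic => inth.
have mA : measurable A by exact: measurable_itv.
have Lnh : L1 A (fun x => `|h x|) by exact: L1_norm.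
have L1c k : L1 A k -> L1 A (aconv k A (-1) eta).
  move=> intk; apply: continuous_L1_itv.
  exact/bounded_derivatives_continuous/bounded_derivatives_aconv.
(* The factor 1 is the function [f] of [Fubini_aconv]. *)
apply: (@le_trans _ _ (\int[mu]_(x in A) (1 * aconv (fun y => `|h y|) A (-1) eta x))).
  apply: L1_le => //.
  - exact/L1_norm/L1c.
  - by apply: L1Z => //; exact: L1c.
  - move=> x _; rewrite mul1r.
    have Lh : L1 A (fun y => h y * eta (x + -1 * y)).
      exact: integrable_mul_affine.
    apply: le_trans (L1_le_norm mA Lh) _.
    rewrite /aconv; under eq_Rintegral do rewrite normrM (ger0_norm (eta0 _)).
    exact: lexx.
have L1c1 : L1 A (cst 1 : R -> R).
  by apply: continuous_L1_itv; exact: cst_continuous.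
rewrite (Fubini_aconv (f := cst 1))//.
(* Recognizing the inner integral as another [aconv] gives its continuity and boundedness, hence the
   integrability of its product with |h|. *)
pose G := aconv (cst 1) A (-1) (fun z => eta (0 + -1 * z)).
have GE y : \int[mu]_(x in A) (1 * eta (x + -1 * y)) = G y.
  by apply: eq_Rintegral => x _; rewrite /=; congr (_ * eta _); ring.
have bG : bounded_derivatives G.
  exact/bounded_derivatives_aconv/bounded_derivatives_affine.
have cG : L1 A (fun y => `|h y| * \int[mu]_(x in A) (1 * eta (x + -1 * y))).
  have -> : (fun y => `|h y| * \int[mu]_(x in A) (1 * eta (x + -1 * y))) =
      (fun y => `|h y| * G (0 + 1 * y)).
    by apply/funext => y; rewrite GE mul1r add0r.
  apply: integrable_mul_affine => //; last exact: bounded_derivatives_bound.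
  exact: bounded_derivatives_continuous.
apply: L1_le => //= y _; rewrite -[leRHS]mulr1 ler_wpM2l//.
under eq_Rintegral do rewrite mul1r addrC -[X in _ + X]mul1r.
by apply: Rintegral_mollifier_le1 => //; left.
Qed.

End one.
End mollification.

(** * Convergence of mollifications *)

Section cvg.
Context {R : realType}.
Local Notation mu := (@lebesgue_measure R).
Implicit Types (a b x : R) (f g h : R -> R).

Lemma cvg_L1P (D : set R) (f_ : nat -> R -> R) f : measurable D ->
  (forall j, L1 D (fun x => f_ j x - f x)) ->
  cvg_L1 D f_ f <->
  \int[mu]_(x in D) `|f_ j x - f x| @[j --> \oo] --> (0 : R).
Proof.
move=> mD intd; rewrite /cvg_L1.
have -> : (fun j => \int[mu]_(x in D) (`|f_ j x - f x|)%:E)%E =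
    (fun j => (\int[mu]_(x in D) `|f_ j x - f x|)%:E).
  by apply/funext => j; rewrite L1_EFin//; exact: L1_norm.
split; first by move/fine_cvgP => [].
by move=> h; apply/fine_cvgP; split => //; exact: nearW.
Qed.

Variables (eta : nat -> R -> R) (delta : nat -> R).
Hypotheses (beta : forall j, bounded_derivatives (eta j))
  (eta0 : forall j x, 0 <= eta j x)
  (etaS : forall j x, ~~ (`|x| < delta j) -> eta j x = 0)
  (eta1 : forall j, \int[mu]_x eta j x = 1)
  (delta0 : delta j @[j --> \oo] --> (0 : R)).

Let L1c a b k j : L1 `]a, b[ k -> L1 `]a, b[ (aconv k `]a, b[ (-1) (eta j)).
Proof.
move=> intk; apply: continuous_L1_itv.
by apply/bounded_derivatives_continuous/bounded_derivatives_aconv.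
Qed.

Lemma aconv_mollifier_pointwise a b g x : continuous g -> a < x < b ->
  aconv g `]a, b[ (-1) (eta j) x @[j --> \oo] --> g x.
Proof.
move=> cg /andP[ax xb]; set A := `]a, b[%classic.
have mA : measurable A by exact: measurable_itv.
have L1g : L1 A g by exact: continuous_L1_itv.
apply/cvgrPdist_le => /= e e0.
have /cvgrPdist_le/(_ _ e0) := cg x.
rewrite near_nbhs => -[d /= d0 dP].
near=> j.
(* The bound [d] keeps the kernel where [g] is close to [g x]; the other two keep it inside (a, b),
   so that it has full mass 1 there. *)
have dj : delta j < Num.min d (Num.min (x - a) (b - x)).
  near: j; apply: cvgr_lt delta0 _ _.
  by rewrite !lt_min d0 !subr_gt0 ax xb.
move: dj; rewrite !lt_min => /and3P[djd dja djb].
have E1 : \int[mu]_(y in A) eta j (x + -1 * y) = 1.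
  rewrite -[RHS](Rintegral_mollifier (beta j) (eta1 j) x (or_intror erefl)).
  rewrite [LHS]Rintegral_mkcond; apply: eq_Rintegral => y _.
  rewrite patchE; case: ifPn => // yA; rewrite (etaS (j := j))//.
  apply: contra yA; rewrite ltr_norml => /andP[h1 h2].
  by rewrite inE /A/= in_itv/=; apply/andP; split; lra.
have Le : L1 A (fun y => eta j (x + -1 * y)).
  apply: (L1_sub mA measurableT) => //.
  by apply: (L1_mollifier (beta j) (@etaS j)); right.
have Lc (c : R) : L1 A (fun=> c) by apply: continuous_L1_itv; exact: cst_continuous.
have -> : g x - aconv g A (-1) (eta j) x =
    aconv (fun y => g x - g y) A (-1) (eta j) x.
  have gE : g x = \int[mu]_(y in A) (g x * eta j (x + -1 * y)).
    by rewrite L1_RintegralZ// E1 mulr1.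
  rewrite {1}gE -L1_RintegralB//.
  - by apply: eq_Rintegral => y _; rewrite mulrBl.
  - exact: L1Z.
  - apply: integrable_mul_affine => //; last exact: bounded_derivatives_bound.
    exact: bounded_derivatives_continuous.
apply: (aconv_mollifier_bound (beta j) (eta0 j) (@etaS j) (eta1 j)) => //.
- exact: L1B.
- exact: ltW.
- move=> y _ xy; apply: dP => /=; exact: lt_trans xy djd.
Unshelve. all: by end_near. Qed.

Lemma aconv_mollifier_continuous_cvg a b g : a < b -> continuous g ->
  \int[mu]_(x in `]a, b[) `|aconv g `]a, b[ (-1) (eta j) x - g x|
    @[j --> \oo] --> (0 : R).
Proof.
move=> ab cg; set A := `]a, b[%classic.
have mA : measurable A by exact: measurable_itv.
have L1g : L1 A g by exact: continuous_L1_itv.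
have cn : continuous (fun x => `|g x|).
  by move=> x; apply: continuous_comp; [exact: cg|exact: norm_continuous].
have [c _ cM] := EVT_max (ltW ab) (continuous_subspaceT cn).
pose M := `|g c|.
have gM y : A y -> `|g y| <= M.
  rewrite /A/= in_itv/= => /andP[ay yb].
  by apply: cM; rewrite in_itv/= !ltW.
have := @dominated_convergence _ _ R mu A mA
  (fun j x => (aconv g A (-1) (eta j) x)%:E) (fun x => (g x)%:E) (fun=> M%:E).
case.
- by move=> j; apply: (L1_measurable_EFin (f := aconv g A (-1) (eta j))); exact: L1c.
- exact: L1_measurable_EFin.
- apply: aeW => x Ax; apply: cvg_EFin; first exact: nearW.
  exact: aconv_mollifier_pointwise.
- by apply: continuous_L1_itv; exact: cst_continuous.
- apply: aeW => x j Ax; rewrite lee_fin.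
  apply: (aconv_mollifier_bound (beta j) (eta0 j) (@etaS j) (eta1 j)) => //.
  + exact: normr_ge0.
  + by move=> y Ay _; exact: gM.
move=> _ h _; apply/(cvg_L1P (f_ := fun j => aconv g A (-1) (eta j)) (f := g)) => //.
by move=> j; apply: L1B => //; exact: L1c.
Qed.

(** Density of continuous functions: writing T for mollification, Tf - f = -T(g - f) + (Tg - g) + (g
    - f). The first term is no larger in norm than the last, as T is a contraction of L^1. *)
Lemma aconv_mollifier_cvg a b f : a < b -> L1 `]a, b[ f ->
  cvg_L1 `]a, b[ (fun j => aconv f `]a, b[ (-1) (eta j)) f.
Proof.
move=> ab intf; set A := `]a, b[%classic.
have mA : measurable A by exact: measurable_itv.
apply/cvg_L1P => //; first by move=> j; apply: L1B => //; exact: L1c.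
have muA : (mu A < +oo)%E.
  by rewrite /A /= lebesgue_measure_itv/=; case: ifPn => _; rewrite ?ltry.
have [g_ [cg_ intg_ g_f]] :=
  @approximation_continuous_integrable R A f mA muA intf.
have {}g_f : \int[mu]_(x in A) `|g_ j x - f x| @[j --> \oo] --> (0 : R).
  apply/cvg_L1P => //.
    by move=> j; apply: L1B => //; exact: intg_.
  rewrite /cvg_L1.
  have -> : (fun j => \int[mu]_(x in A) (`|g_ j x - f x|)%:E)%E =
      (fun j => \int[mu]_(x in A) `|(f x - g_ j x)%:E|)%E.
    by apply/funext => j; apply: eq_integral => x _; rewrite distrC.
  exact: g_f.
apply/cvgr0Pnorm_le => e e0.
have e3 : 0 < e / 3 by rewrite divr_gt0.
have /cvgr0Pnorm_le/(_ _ e3)[N _ /(_ N (leqnn N)) /= gN] := g_f.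
set g := g_ N in gN.
have cg : continuous g := cg_ N.
have intg : L1 A g := intg_ N.
have /cvgr0Pnorm_le/(_ _ e3) := aconv_mollifier_continuous_cvg ab cg.
apply: filterS => j /= gj.
have Lgf : L1 A (fun x => g x - f x) by exact: L1B.
move: gN gj.
rewrite !ger0_norm; do ?exact: Rintegral_ge0.
move=> gN gj.
have LT := aconv_mollifier_L1 (beta j) (eta0 j) (@etaS j) (eta1 j) Lgf.
have TB x : aconv (fun x => g x - f x) A (-1) (eta j) x =
    aconv g A (-1) (eta j) x - aconv f A (-1) (eta j) x.
  have Lm k : L1 A k -> L1 A (fun y => k y * eta j (x + -1 * y)).
    move=> intk; apply: integrable_mul_affine => //; last exact: bounded_derivatives_bound.
    exact: bounded_derivatives_continuous.
  rewrite -L1_RintegralB; [|exact: mA|exact: Lm|exact: Lm].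
  by apply: eq_Rintegral => y _; rewrite mulrBl.
have La := L1_norm (L1c j Lgf).
have Lb := L1_norm (L1B mA (L1c j intg) intg).
have Lc := L1_norm Lgf.
apply: (@le_trans _ _ (\int[mu]_(x in A)
   ((`|aconv (fun x => g x - f x) A (-1) (eta j) x| +
    `|aconv g A (-1) (eta j) x - g x|) + `|g x - f x|))).
  apply: L1_le => //.
  - by apply/L1_norm/L1B => //; exact: L1c.
  - by do 2 apply: L1D => //.
  - move=> x _; rewrite TB -(normrN (_ - aconv f A _ _ _)).
    apply: le_trans (lerD (ler_normD _ _) (lexx _)).
    apply: le_trans (ler_normD _ _); rewrite le_eqVlt; apply/orP; left; apply/eqP.
    by congr (`| _ |); ring.
have -> : forall k1 k2 k3 : R -> R, L1 A k1 -> L1 A k2 -> L1 A k3 ->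
    \int[mu]_(x in A) (k1 x + k2 x + k3 x) = \int[mu]_(x in A) k1 x +
    \int[mu]_(x in A) k2 x + \int[mu]_(x in A) k3 x.
  move=> k1 k2 k3 i1 i2 i3.
  rewrite (@RintegralD _ _ _ mu A (fun x => k1 x + k2 x) k3)//; last exact: L1D.
  by rewrite (@RintegralD _ _ _ mu A k1 k2).
- by move: LT gN gj; rewrite -/A; lra.
- exact: La.
- exact: Lb.
- exact: Lc.
Qed.

End cvg.

(** * Weak fractional derivatives *)

Section weak.
Context {R : realType}.
Local Notation mu := (@lebesgue_measure R).
Implicit Types (u v phi eta : R -> R).

Lemma Rintegral_support (A : set R) f : (forall x, ~ A x -> f x = 0) ->
  \int[mu]_(x in A) f x = \int[mu]_x f x.
Proof.
move=> f0; rewrite Rintegral_mkcond; apply: eq_Rintegral => x _.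
by rewrite patchE; case: ifPn => // /negP xA; rewrite f0// => Ax; apply/xA/mem_set.
Qed.

Lemma locally_integrable_L1 (D K : set R) f : locally_integrable D f ->
  compact K -> K `<=` D -> L1 K f.
Proof.
move=> [mf oD intf] cK KD; apply/integrableP; split; last exact: intf.
have mD : measurable D by exact: open_measurable.
apply/measurable_EFinP; exact: (measurable_funS mD KD).
Qed.

Lemma cvg_L1_Rintegral_mul (D : set R) (f_ : nat -> R -> R) (f g : R -> R)
    (M : R) :
  measurable D -> (forall j, L1 D (f_ j)) -> L1 D f -> cvg_L1 D f_ f ->
  measurable_fun D g -> (forall x, D x -> `|g x| <= M) ->
  \int[mu]_(x in D) (f_ j x * g x) @[j --> \oo] --> \int[mu]_(x in D) (f x * g x).
Proof.
move=> mD intf_ intf cf mg gM.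
have intB j : L1 D (fun x => f_ j x - f x) by exact: L1B.
have cI := (cvg_L1P mD intB).1 cf.
have intm k : L1 D k -> L1 D (fun x => k x * g x).
  by move=> intk; exact: (integrable_mul_bounded mD intk mg gM).
apply/subr_cvg0/norm_cvg0P.
apply: (@squeeze_cvgr _ _ _ _ (cst 0)
    (fun j => `|M| * \int[mu]_(x in D) `|f_ j x - f x|)); last 2 first.
- exact: cvg_cst.
- by rewrite -[X in _ --> X](mulr0 `|M|); apply: cvgM => //; exact: cvg_cst.
apply: nearW => j; rewrite normr_ge0/= -L1_RintegralB//; [|exact: intm|exact: intm].
rewrite -L1_RintegralZ//; last exact: L1_norm.
have Lm : L1 D (fun x => f_ j x * g x - f x * g x) by apply: L1B => //; exact: intm.
apply: le_trans (L1_le_norm mD Lm) _; apply: L1_le => //.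
- exact: L1_norm.
- by apply: L1Z => //; exact: L1_norm.
- move=> x Dx; rewrite -mulrBl normrM mulrC ler_wpM2r//.
  by rewrite (le_trans (gM x Dx))// ler_norm.
Qed.

Section side.
Variables (s : side) (a b alpha : R).
Hypotheses (ab : a < b) (ha1 : alpha < 1).

Local Notation A := (`]a, b[%classic : set R).
Local Notation I := (`]0, (b - a)[%classic : set R).
Local Notation e := (@side_sign R s).
Local Notation c := ((Gamma (1 - alpha))^-1 : R).
Local Notation K := (rl_kernel alpha).

Let mA : measurable A. Proof. exact: measurable_itv. Qed.
Let mI : measurable I. Proof. exact: measurable_itv. Qed.
Let L1K : L1 I K. Proof. by apply: L1_rl_kernel => //; rewrite subr_gt0. Qed.

(** The function G_j of the overview, in which the derivative falls on [eta]. If [eta] vanishes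
    where e * x <= 0, cutting the integral at t = b - a loses nothing for |z| < b - a, and
    differences of points of (a, b) satisfy this. *)
Definition mollifier_RL eta : R -> R :=
  fun z => e * c * aconv K I (- e) (derive1 eta) z.

Lemma bounded_derivatives_mollifier_RL eta : bounded_derivatives eta ->
  bounded_derivatives (mollifier_RL eta).
Proof.
move=> beta; apply: bounded_derivativesZ; apply: bounded_derivatives_aconv => //.
exact: bounded_derivatives_derive1.
Qed.

Lemma RL_deriv_bounded_derivatives phi : test_function A phi ->
  exists2 D : R -> R, bounded_derivatives D &
    forall x, A x -> RL_deriv (opposite s) a b alpha phi x = D x.
Proof.
move=> tphi; exists (fun x => - e * c * aconv K I e (derive1 phi) x).
  apply: bounded_derivativesZ; apply: bounded_derivatives_aconv => //.
  exact/bounded_derivatives_derive1/(test_function_bounded_derivatives ab).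
by move=> x; rewrite /= in_itv/= => xab; exact: RL_deriv_aconv.
Qed.

(** The two sides are asymmetric. Against [v_], the test function has compact support, so local
    convergence is enough. Against [u_], its fractional derivative is nonlocal and need not have
    compact support in (a, b), so convergence on all of (a, b) is used. *)
Lemma is_weak_frac_deriv_limit u v (u_ v_ : nat -> R -> R) :
  L1 A u -> locally_integrable A v ->
  (forall j, is_weak_frac_deriv s a b alpha (u_ j) (v_ j)) ->
  cvg_L1 A u_ u -> cvg_L1loc A v_ v ->
  is_weak_frac_deriv s a b alpha u v.
Proof.
move=> hu hv wd cu cv; split => // phi tphi.
have [D bD DE] := RL_deriv_bounded_derivatives tphi.
have [_ [M1 DM]] := bD 0%N.
have bphi := test_function_bounded_derivatives ab tphi.
have [_ [M2 phiM]] := bphi 0%N.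
have [_ cS SA] := tphi.
set S := closure [set x | phi x != 0] in cS SA.
have mS : measurable S by exact: compact_measurable.
have phi0 x : ~ S x -> phi x = 0.
  by move=> Sx; apply: contrapT => /eqP h; apply: Sx; exact: subset_closure.
have phiE (w : R -> R) : \int[mu]_(x in A) (w x * phi x) =
    \int[mu]_(x in S) (w x * phi x).
  transitivity (\int[mu]_x (w x * phi x)).
    apply: Rintegral_support => x nx; rewrite phi0 ?mulr0//.
    by apply: contra_not nx; exact: SA.
  by apply/esym/Rintegral_support => x nx; rewrite phi0 ?mulr0.
have DphiE (w : R -> R) :
    \int[mu]_(x in A) (w x * RL_deriv (opposite s) a b alpha phi x) =
    \int[mu]_(x in A) (w x * D x).
  by apply: eq_Rintegral => x /set_mem Ax; rewrite DE.
have L1v w : locally_integrable A w -> L1 S w.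
  by move=> lw; exact: (locally_integrable_L1 lw).
have cD := bounded_derivatives_continuous bD.
have cphi := bounded_derivatives_continuous bphi.
have c1 : \int[mu]_(x in S) (v_ j x * phi x) @[j --> \oo] -->
    \int[mu]_(x in S) (v x * phi x).
  apply: (@cvg_L1_Rintegral_mul _ _ _ _ M2) => //.
  - by move=> j; apply: L1v; case: (wd j).
  - exact: L1v.
  - exact: cv.
  - by apply: measurable_funTS; exact: continuous_measurable_fun.
have c2 : \int[mu]_(x in A) (u_ j x * D x) @[j --> \oo] -->
    \int[mu]_(x in A) (u x * D x).
  apply: (@cvg_L1_Rintegral_mul _ _ _ _ M1) => //.
  - by move=> j; case: (wd j).
  - by apply: measurable_funTS; exact: continuous_measurable_fun.
have E : (fun j => \int[mu]_(x in S) (v_ j x * phi x)) =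
    (fun j => \int[mu]_(x in A) (u_ j x * D x)).
  by apply/funext => j; rewrite -phiE -DphiE; case: (wd j) => _ _; apply.
rewrite phiE DphiE; rewrite E in c1.
by apply: cvg_unique c1 c2; exact: norm_hausdorff.
Qed.

End side.
End weak.

(** * The mollified function and its weak derivative *)

Section mollified.
Context {R : realType}.
Local Notation mu := (@lebesgue_measure R).
Implicit Types (u v phi : R -> R).
Variables (s : side) (a b alpha : R).
Hypotheses (ab : a < b) (ha1 : alpha < 1).

Local Notation A := (`]a, b[%classic : set R).
Local Notation I := (`]0, (b - a)[%classic : set R).
Local Notation e := (@side_sign R s).
Local Notation c := ((Gamma (1 - alpha))^-1 : R).
Local Notation K := (rl_kernel alpha).

Let mA : measurable A. Proof. exact: measurable_itv. Qed.
Let mI : measurable I. Proof. exact: measurable_itv. Qed.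
Let L1K : L1 I K. Proof. by apply: L1_rl_kernel => //; rewrite subr_gt0. Qed.

Variables (eta : R -> R) (delta : R).
Hypotheses (beta : bounded_derivatives eta)
  (etaS : forall x, ~~ (0 < e * x < delta) -> eta x = 0).

Let bdeta := bounded_derivatives_derive1 beta.
Let bphi phi : test_function A phi -> bounded_derivatives phi.
Proof. exact: test_function_bounded_derivatives. Qed.

(* Both sides are the integral over the line of [phi' (x + e * t) * eta (x - y)],
   up to sign; that [eta] lives on the side [e * x > 0] is what makes the
   truncation to [A] harmless. *)
Lemma mollifier_by_parts phi y t : test_function A phi -> A y -> 0 < t ->
  \int[mu]_(x in A) (phi x * derive1 eta (- y + 1 * (x + - e * t))) =
  - \int[mu]_(x in A) (eta (x + -1 * y) * derive1 phi (x + e * t)).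
Proof.
move=> tphi Ay t0; have bp := bphi tphi.
have phi0 x : ~~ (a < x < b) -> phi x = 0 by exact: (test_function_eq0 tphi 0).
have dphi0 x : ~~ (a < x < b) -> derive1 phi x = 0.
  exact: (test_function_eq0 tphi 1).
pose w := - y + - e * t.
pose G x := eta (w + 1 * x).
have bG : bounded_derivatives G by exact: bounded_derivatives_affine.
have GE : derive1 G = fun x => 1 * derive1 eta (w + 1 * x).
  exact: derive1_affine.
have cw g : bounded_derivatives g -> {within `[a, b], continuous g}.
  move=> bg; apply: continuous_subspaceT.
  exact: bounded_derivatives_continuous.
have dLR g : bounded_derivatives g -> derivable_oo_LRcontinuous g a b.
  move=> bg; have cg := bounded_derivatives_continuous bg; split.
  - by move=> x _; case: (bg 0%N).
  - by apply: cvg_at_right_filter; exact: cg.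
  - by apply: cvg_at_left_filter; exact: cg.
have := @Rintegration_by_parts R phi G (derive1 phi) (derive1 G) a b ab
  (cw _ (bounded_derivatives_derive1 bp)) (dLR _ bp) (fun x _ => erefl)
  (cw _ (bounded_derivatives_derive1 bG)) (dLR _ bG) (fun x _ => erefl).
(* The boundary terms vanish because [phi] does at both ends. *)
rewrite (phi0 a) ?ltxx// (phi0 b) ?ltxx ?andbF// !mul0r subrr sub0r.
have suppA (f : R -> R) : (forall x, ~~ (a < x < b) -> f x = 0) ->
    \int[mu]_(x in A) f x = \int[mu]_x f x.
  move=> f0; apply: Rintegral_support => x /=; rewrite in_itv/= => /negP.
  exact: f0.
have suppC (f : R -> R) : (forall x, ~~ (a < x < b) -> f x = 0) ->
    \int[mu]_(x in `[a, b]) f x = \int[mu]_x f x.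
  move=> f0; apply: Rintegral_support => x /=; rewrite in_itv/= => /negP nx.
  by apply: f0; apply: contra nx => /andP[/ltW -> /ltW ->].
rewrite (suppC (fun x => phi x * derive1 G x)); last first.
  by move=> x nx; rewrite phi0// mul0r.
rewrite (suppC (fun x => derive1 phi x * G x)); last first.
  by move=> x nx; rewrite dphi0// mul0r.
move=> ibp.
transitivity (\int[mu]_x (phi x * derive1 G x)).
  rewrite [LHS]suppA; last by move=> x nx; rewrite phi0// mul0r.
  apply: eq_Rintegral => x _; congr (_ * _); rewrite GE [RHS]mul1r.
  by congr (derive1 eta _); rewrite /w; ring.
rewrite ibp; congr (- _).
rewrite -(@Rintegral_affine _ (e * t) 1 (fun x => derive1 phi x * G x)); first last.
- apply: continuous_measurable_fun => x; apply: continuousM.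
    exact/bounded_derivatives_continuous/bounded_derivatives_derive1.
  exact: bounded_derivatives_continuous.
- by left.
rewrite [RHS]suppA.
  apply: eq_Rintegral => x _; rewrite mulrC /G /w; congr (eta _ * derive1 phi _).
    by ring.
  by ring.
move=> x nx.
(* When e = 1, a nonzero product forces x > y > a from [eta] and x < x + t < b from phi', so x lies
   in (a, b); e = -1 is the mirror image. *)
have [h1|h1] := boolP (0 < e * (x + -1 * y) < delta); last by rewrite etaS// mul0r.
have [h2|h2] := boolP (a < x + e * t < b); last by rewrite dphi0// mulr0.
exfalso; apply: (negP nx); move: Ay h1 h2 t0; rewrite /= in_itv/=.
case: (@side_signP R s) => ->; rewrite ?mul1r ?mulN1r.
  by move=> /andP[ay yb] /andP[h1 _] /andP[h2 h3] t0; apply/andP; split; lra.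
by move=> /andP[ay yb] /andP[h1 _] /andP[h2 h3] t0; apply/andP; split; lra.
Qed.

(** Fractional integration by parts: Fubini brings the variable t of the kernel outside on both
    sides, and [mollifier_by_parts] then compares the inner integrals for each t. *)
Lemma mollifier_RL_duality phi y : test_function A phi -> A y ->
  \int[mu]_(x in A) (phi x * mollifier_RL s a b alpha eta (x + -1 * y)) =
  \int[mu]_(x in A) (RL_deriv (opposite s) a b alpha phi x * eta (x + -1 * y)).
Proof.
move=> tphi Ay; have bp := bphi tphi; have bdp := bounded_derivatives_derive1 bp.
have cphi := bounded_derivatives_continuous bp.
have L1phi : L1 A phi by exact: continuous_L1_itv.
have beta' : bounded_derivatives (fun x => eta (- y + 1 * x)).
  exact: bounded_derivatives_affine.
have L1eta : L1 A (fun x => eta (x + -1 * y)).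
  apply: continuous_L1_itv.
  have -> : (fun x => eta (x + -1 * y)) = (fun x => eta (- y + 1 * x)).
    by apply/funext => x; congr eta; ring.
  exact: bounded_derivatives_continuous.
pose g z := derive1 eta (- y + 1 * z).
have bg : bounded_derivatives g by exact: bounded_derivatives_affine.
have ba sg h : bounded_derivatives h -> bounded_derivatives (aconv K I sg h).
  by move=> bh; exact: bounded_derivatives_aconv.
have mul_L1 f h : L1 A f -> bounded_derivatives h -> L1 A (fun x => f x * h x).
  move=> intf bh; have [_ [M hM]] := bh 0%N.
  apply: (integrable_mul_bounded (M := M)) => //.
  apply: measurable_funTS; apply: continuous_measurable_fun.
  exact: bounded_derivatives_continuous.
transitivity (e * c * \int[mu]_(x in A) (phi x * aconv K I (- e) g x)).
  have Lp := mul_L1 _ _ L1phi (ba (- e) _ bg).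
  rewrite -(@L1_RintegralZ R A (e * c) _ mA Lp).
  apply: eq_Rintegral => x _; rewrite /mollifier_RL mulrCA.
  have -> : aconv K I (- e) (derive1 eta) (x + -1 * y) = aconv K I (- e) g x.
    apply: eq_Rintegral => t _.
    have -> : x + -1 * y + - e * t = - y + 1 * (x + - e * t) by ring.
    by [].
  by [].
transitivity (- e * c *
    \int[mu]_(x in A) (eta (x + -1 * y) * aconv K I e (derive1 phi) x)); last first.
  have Lp := mul_L1 _ _ L1eta (ba e _ bdp).
  rewrite -(@L1_RintegralZ R A (- e * c) _ mA Lp).
  apply: eq_Rintegral => x /set_mem; rewrite /= in_itv/= => Ax.
  by rewrite RL_deriv_aconv// mulrCA mulrC.
have F1 := Fubini_aconv (- e) mA mI L1phi L1K
  (bounded_derivatives_continuous bg) (bounded_derivatives_bound bg).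
have F2 := Fubini_aconv e mA mI L1eta L1K
  (bounded_derivatives_continuous bdp) (bounded_derivatives_bound bdp).
rewrite [X in _ * X = _]F1 [X in _ = _ * X]F2 {F1 F2}.
rewrite [X in _ = X * _]mulNr [RHS]mulNr -[RHS]mulrN; congr (_ * _).
(* As an [aconv], the inner integral is a bounded continuous function of t, so its product with the
   kernel is integrable and the sign can be moved through the integral. *)
pose h := aconv (fun x => eta (x + -1 * y)) A e (fun z => derive1 phi (0 + e * z)).
have hE t : \int[mu]_(x in A) (eta (x + -1 * y) * derive1 phi (x + e * t)) =
    h (0 + 1 * t).
  apply: eq_Rintegral => x _; congr (_ * derive1 phi _).
  by case: (@side_signP R s) => ->; ring.
have Lh : L1 I (fun t => K t *
    \int[mu]_(x in A) (eta (x + -1 * y) * derive1 phi (x + e * t))).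
  have bh : bounded_derivatives h.
    by apply: bounded_derivatives_aconv => //; exact: bounded_derivatives_affine.
  have -> : (fun t => K t *
      \int[mu]_(x in A) (eta (x + -1 * y) * derive1 phi (x + e * t))) =
      (fun t => K t * h (0 + 1 * t)) by apply/funext => t; rewrite hE.
  apply: integrable_mul_affine => //; last exact: bounded_derivatives_bound.
  exact: bounded_derivatives_continuous.
rewrite -[RHS]mulN1r -[RHS](@L1_RintegralZ R I (-1) _ mI Lh).
apply: eq_Rintegral => t /set_mem; rewrite /= in_itv/= => /andP[t0 _].
rewrite [RHS]mulN1r -[RHS]mulrN; congr (_ * _).
exact: mollifier_by_parts.
Qed.

Lemma is_weak_frac_deriv_mollified u : L1 A u ->
  is_weak_frac_deriv s a b alpha (aconv u A (-1) eta)
    (aconv u A (-1) (mollifier_RL s a b alpha eta)).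
Proof.
move=> hu.
have bG : bounded_derivatives (mollifier_RL s a b alpha eta).
  exact: bounded_derivatives_mollifier_RL.
have L1a g : bounded_derivatives g -> L1 A (aconv u A (-1) g).
  move=> bg; apply: continuous_L1_itv; apply: bounded_derivatives_continuous.
  exact: bounded_derivatives_aconv.
split; first exact: L1a.
  apply: open_integrable_locally; first exact: interval_open.
  exact: L1a.
move=> phi tphi; have bp := bphi tphi.
have [D bD DE] := RL_deriv_bounded_derivatives s ab ha1 tphi.
have DE' w : \int[mu]_(x in A) (RL_deriv (opposite s) a b alpha phi x * w x) =
    \int[mu]_(x in A) (D x * w x).
  by apply: eq_Rintegral => x /set_mem Ax; rewrite DE.
under eq_Rintegral do rewrite mulrC.
under [RHS]eq_Rintegral do rewrite mulrC.
have L1D : L1 A D.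
  by apply: continuous_L1_itv; exact: bounded_derivatives_continuous.
have L1phi : L1 A phi.
  by apply: continuous_L1_itv; exact: bounded_derivatives_continuous.
have F1 := Fubini_aconv (-1) mA mA L1phi hu
  (bounded_derivatives_continuous bG) (bounded_derivatives_bound bG).
have F2 := Fubini_aconv (-1) mA mA L1D hu
  (bounded_derivatives_continuous beta) (bounded_derivatives_bound beta).
rewrite [RHS]DE' [LHS]F1 [RHS]F2 {F1 F2}.
apply: eq_Rintegral => y /set_mem Ay; congr (_ * _).
by rewrite [LHS]mollifier_RL_duality// [LHS]DE'.
Qed.

(** The margin [delta] makes y |-> eta (x - y) an admissible test function. Reflection exchanges the
    two sides, and the factor -1 of the chain rule cancels the sign of the opposite derivative,
    leaving [mollifier_RL] at x - y. *)
Lemma aconv_mollifier_RL u v x : is_weak_frac_deriv s a b alpha u v ->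
  a < x - delta -> x + delta < b ->
  aconv u A (-1) (mollifier_RL s a b alpha eta) x = aconv v A (-1) eta x.
Proof.
move=> [hu hv wd] ax xb.
pose phi y := eta (x + -1 * y).
have bp : bounded_derivatives phi by exact: bounded_derivatives_affine.
have tphi : test_function A phi.
  apply: (test_functionP ax xb) => // y ny; apply: etaS; apply: contra ny.
  by case: (@side_signP R s) => -> /andP[h1 h2]; apply/andP; split; lra.
transitivity (\int[mu]_(y in A) (v y * phi y)); last by [].
rewrite (wd _ tphi); apply: eq_Rintegral => y /set_mem Ay.
have -> : RL_deriv (opposite s) a b alpha phi y =
    e * c * - aconv K I e (derive1 phi) y.
  by rewrite RL_deriv_aconv// !mulNr mulrN.
congr (_ * _).
rewrite /mollifier_RL; congr (_ * _).
have bdphi : bounded_derivatives (derive1 phi) by exact: bounded_derivatives_derive1.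
have Lk : L1 I (fun t => K t * derive1 phi (y + e * t)).
  apply: integrable_mul_affine => //; last exact: bounded_derivatives_bound.
  exact: bounded_derivatives_continuous.
rewrite -[RHS]mulN1r -[RHS](@L1_RintegralZ R I (-1) _ mI Lk).
apply: eq_Rintegral => t _; rewrite [RHS]mulN1r -[RHS]mulrN; congr (_ * _).
rewrite /phi derive1_affine//.
have -> : x + -1 * y + - e * t = x + -1 * (y + e * t) by ring.
by rewrite [in RHS]mulNr mul1r opprK.
Qed.

End mollified.

(** * Construction of the approximating sequence *)

Section approximation.
Context {R : realType}.
Local Notation mu := (@lebesgue_measure R).

Lemma side_mollifier (s : side) (delta : R) : 0 < delta ->
  exists eta : R -> R,
  [/\ bounded_derivatives eta, forall x, 0 <= eta x,
      forall x, ~~ (0 < side_sign s * x < delta) -> eta x = 0 &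
      \int[mu]_x eta x = 1].
Proof.
move=> d0; case: s => /=.
  have [eta [h1 h2 h3 h4]] := mollifier d0.
  by exists eta; split => // x; rewrite mul1r; exact: h3.
have dN0 : - delta < 0 by rewrite oppr_lt0.
have [eta [h1 h2 h3 h4]] := mollifier dN0.
exists eta; split => // x; rewrite mulN1r => nx; apply: h3.
by apply: contra nx => /andP[? ?]; apply/andP; split; lra.
Qed.

Lemma compact_sub_itvoo (a b : R) (S : set R) : a < b -> compact S ->
  S `<=` `]a, b[ -> exists p q, [/\ a < p, p < q, q < b & S `<=` `]p, q[].
Proof.
move=> ab cS SA.
have [S0|/set0P/negP/negPn/eqP S0] := pselect (S !=set0); last first.
  (* An empty set has no extrema to build on; the middle third of (a, b) will do. *)
  exists ((2 * a + b) / 3), ((a + 2 * b) / 3); split; [lra|lra|lra|].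
  by rewrite S0; exact: sub0set.
have cid : {within S, continuous (id : R -> R)}.
  by apply: continuous_subspaceT => x; exact: cvg_id.
have [M MS hM] := compact_EVT_max S0 cS cid.
have [m mS hm] := compact_EVT_min S0 cS cid.
have mM : m <= M by exact: hM.
move: (SA _ (set_mem MS)) (SA _ (set_mem mS)); rewrite /= !in_itv/=.
move=> /andP[aM Mb] /andP[am mb].
exists ((a + m) / 2), ((M + b) / 2); split; [lra|lra|lra|].
move=> x Sx /=; rewrite in_itv/=.
have h1 := hM _ (mem_set Sx); have h2 := hm _ (mem_set Sx).
by apply/andP; split; lra.
Qed.

Lemma aconv_subset (A B : set R) (f eta : R -> R) x : B `<=` A ->
  (forall y, A y -> ~ B y -> eta (x + -1 * y) = 0) ->
  aconv f A (-1) eta x = aconv f B (-1) eta x.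
Proof.
move=> BA eta0; rewrite /aconv [LHS]Rintegral_mkcond [RHS]Rintegral_mkcond.
apply: eq_Rintegral => y _; rewrite !patchE.
have [yB|/negP yB] := boolP (y \in B); first by rewrite ifT//; exact/mem_set/BA/set_mem.
case: ifPn => // /set_mem yA; rewrite eta0 ?mulr0// => By.
by apply: yB; exact: mem_set.
Qed.

Lemma is_weak_frac_deriv_approximation (s : side) (a b alpha : R) (u v : R -> R) :
  a < b -> alpha < 1 -> is_weak_frac_deriv s a b alpha u v ->
  exists u_ v_ : nat -> R -> R,
    [/\ forall j, smooth_on `]a, b[ (u_ j),
        forall j, is_weak_frac_deriv s a b alpha (u_ j) (v_ j),
        cvg_L1 `]a, b[ u_ u &
        cvg_L1loc `]a, b[ v_ v].
Proof.
move=> ab ha1 wd; have [hu hv _] := wd.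
pose delta (j : nat) : R := j.+1%:R^-1.
have delta_gt0 j : 0 < delta j by rewrite invr_gt0.
have [eta heta] := choice (fun j => side_mollifier s (delta_gt0 j)).
have beta j : bounded_derivatives (eta j) by case: (heta j).
have eta0 j x : 0 <= eta j x by case: (heta j).
have etaS j x : ~~ (0 < side_sign s * x < delta j) -> eta j x = 0.
  by case: (heta j) => _ _ + _; apply.
have eta1 j : \int[mu]_x eta j x = 1 by case: (heta j).
have etaS' j x : ~~ (`|x| < delta j) -> eta j x = 0.
  move=> nx; apply: etaS; apply: contra nx; rewrite ltr_norml.
  by case: (@side_signP R s) => -> /andP[? ?]; apply/andP; split; lra.
have delta0 : delta j @[j --> \oo] --> (0 : R) by exact: cvg_harmonic.
have mA : measurable (`]a, b[%classic : set R) by exact: measurable_itv.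
exists (fun j => aconv u `]a, b[ (-1) (eta j)).
exists (fun j => aconv u `]a, b[ (-1) (mollifier_RL s a b alpha (eta j))).
split.
- by move=> j n x _; case: (bounded_derivatives_aconv (-1) mA hu (beta j) n).
- by move=> j; exact: (is_weak_frac_deriv_mollified ab ha1 (beta j) (@etaS j) hu).
- exact: (aconv_mollifier_cvg beta eta0 etaS' eta1 delta0 ab hu).
move=> S SA cS.
(* Since [v] need not be integrable up to [a] and [b], L^1 mollification is applied on (p, q), whose
   closure lies in (a, b). The second interval (p', q') leaves a gap around [S]: once [delta j] is
   below it, the kernels centred at points of [S] live inside (p, q). *)
have [p [q [ap pq qb SB]]] := compact_sub_itvoo ab cS SA.
have [p' [q' [pp' p'q' q'q SB']]] := compact_sub_itvoo pq cS SB.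
set B := `]p, q[%classic in SB.
have mB : measurable B by exact: measurable_itv.
have mS : measurable S by exact: compact_measurable.
have BA : B `<=` `]a, b[.
  by move=> x; rewrite /B /= !in_itv/= => /andP[? ?]; apply/andP; split; lra.
have L1v : L1 B v.
  apply: (@L1_sub _ _ `[p, q]); [exact: mB|exact: measurable_itv|exact: subset_itv_oo_cc|].
  apply: (locally_integrable_L1 hv); first exact: segment_compact.
  by move=> x /=; rewrite !in_itv/= => /andP[? ?]; apply/andP; split; lra.
have cB := aconv_mollifier_cvg beta eta0 etaS' eta1 delta0 pq L1v.
have L1d j : L1 B (fun x => aconv v B (-1) (eta j) x - v x).
  apply: L1B => //; apply: continuous_L1_itv; apply: bounded_derivatives_continuous.
  exact: bounded_derivatives_aconv.
rewrite /cvg_L1.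
apply: (@squeeze_cvge _ _ _ _ (cst 0%E) _
  (fun j => (\int[mu]_(x in B) (`|aconv v B (-1) (eta j) x - v x|)%:E)%E));
  [|exact: cvg_cst|exact: cB].
near=> j.
have dj : delta j < Num.min (p' - p) (q - q').
  near: j; apply: cvgr_lt delta0 _ _.
  by rewrite lt_min !subr_gt0 pp' q'q.
move: dj; rewrite lt_min => /andP[djp djq].
rewrite integral_ge0//=.
have E x : S x -> aconv u `]a, b[ (-1) (mollifier_RL s a b alpha (eta j)) x =
    aconv v B (-1) (eta j) x.
  move=> /SB'; rewrite /= in_itv/= => /andP[p'x xq'].
  rewrite (aconv_mollifier_RL ab ha1 (beta j) (@etaS j) wd); [|lra|lra].
  apply: aconv_subset => // y _ yB; apply: etaS'; apply: contra_notN yB.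
  by rewrite ltr_norml /B /= in_itv/= => /andP[? ?]; apply/andP; split; lra.
under eq_integral => x /set_mem Sx do rewrite E//.
apply: ge0_subset_integral => //.
exact: (L1_measurable_EFin (L1_norm (L1d j))).
Unshelve. all: by end_near. Qed.

End approximation.

Theorem theorem4p1 (R : realType) (s : side) (a b alpha : R) (u v : R -> R)
    (hab : a < b) (ha0 : 0 < alpha) (ha1 : alpha < 1)
    (hu : L1 `]a, b[ u) (hv : locally_integrable `]a, b[ v) :
  is_weak_frac_deriv s a b alpha u v <->
  exists u_ v_ : nat -> R -> R,
    [/\ forall j, smooth_on `]a, b[ (u_ j),
        forall j, is_weak_frac_deriv s a b alpha (u_ j) (v_ j),
        cvg_L1 `]a, b[ u_ u &
        cvg_L1loc `]a, b[ v_ v].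
Proof.
split; first exact: is_weak_frac_deriv_approximation.
move=> [u_ [v_ [_ wd cu cv]]].
exact: (is_weak_frac_deriv_limit hab ha1 hu hv wd cu cv).
Qed.
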